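(* For every integer $n\ge 3$ there exist constants $C=C(n)>0$ and $\theta=\theta(n)\in(0,1)$, depending only on $n$, such that the following holds for every integer $m\ge 2$. Sample a uniform spanning tree $T$ of $G_{n,m}=C_n\times P_m$ by Wilson's algorithm, with the root being a vertex of one of the two boundary rings $R_0,R_{m-1}$ and with the first random walk started from a vertex of the other boundary ring. Let $L\subset T$ be the first loop-erased path produced by the algorithm. Then $L$ is a trunk of $T$, and for every integer $l\ge 0$, $$\mathbb{P}\bigl(T\text{ has a branch off }L\text{ of length at least }l\bigr)\;\le\; C\,m\,(n-1)\,\theta^{\,l}.$$
   Context: For $n\ge 3$, $m\ge 2$, the cylindrical graph $G_{n,m}=C_n\times P_m$ has vertex set $\{(i,j): i\in\mathbb{Z}_n,\ j\in\{0,\dots,m-1\}\}$ and edges $\{(i,j),(i+1,j)\}$ ($i\in\mathbb{Z}_n$, $0\le j\le m-1$) and $\{(i,j),(i,j+1)\}$ ($i\in\mathbb{Z}_n$, $0\le j\le m-2$). Its rings are $R_k=\{(i,k): i\in\mathbb{Z}_n\}$, $k=0,\dots,m-1$; the boundary rings are $R_0$ and $R_{m-1}$. A uniform spanning tree of a finite connected graph is a spanning tree chosen uniformly among all its spanning trees. Loop-erasure: for a finite path $\gamma$, its (chronological) loop-erasure is obtained by iteratively erasing cycles in chronological order: whenever the path first revisits a vertex, delete the loop formed between the two occurrences. The result is a simple path with the same endpoints as $\gamma$. Wilson's algorithm on a finite connected graph $G=(V,E)$: choose a root $r\in V$ and an ordering of $V\setminus\{r\}$. Starting with the tree $\{r\}$,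 repeatedly take the first vertex in the ordering not yet in the current tree, run (independently of the past) simple random walk from it (each step moves to a uniformly chosen neighbour) until it first hits the current tree, and add the loop-erasure of this walk to the tree. The final tree is a uniform spanning tree. A trunk of a spanning tree $T$ of $G_{n,m}$ is a simple path $L\subset T$ with $L\cap R_k\neq\varnothing$ for every $k=0,\dots,m-1$. Given a trunk $L\subset T$, every connected component $B$ of $T\setminus V(L)$ is adjacent in $T$ to a unique vertex $a(B)\in V(L)$; the corresponding branch off $L$ is the subtree induced by $V(B)\cup\{a(B)\}$, and its length is $\max_{v\in V(B)} d_T(v,a(B))$, where $d_T$ is the graph distance in $T$. *)

(* Defs.v *)
From mathcomp Require Import all_boot all_order all_algebra.
From mathcomp Require Import all_classical all_reals all_analysis.

Set Implicit Arguments.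
Unset Strict Implicit.
Unset Printing Implicit Defensive.

Import Order.TTheory GRing.Theory Num.Theory.

(* A finite simple graph is a symmetric irreflexive [e : rel V] on a finType;
   an edge is the two-element set of its endpoints, and a subgraph is given by
   its set of edges [T : {set {set V}}]. *)
Section Graphs.
Local Open Scope nat_scope.
Variable V : finType.
Implicit Types (e : rel V) (T : {set {set V}}) (B : {set V}) (L : seq V).

Definition edges e : {set {set V}} :=
  [set [set p.1; p.2] | p in [pred p : V * V | e p.1 p.2]]%SET.

Definition tadj T : rel V := [rel u v | [set u; v]%SET \in T].

Definition acyclic e : Prop :=
  forall c : seq V, 2 < size c -> uniq c -> ~~ cycle e c.

Definition spanning_tree e T : Prop :=
  [/\ T \subset edges e, forall u v, connect (tadj T) u v & acyclic (tadj T)].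

Definition simple_path_in T L : Prop := uniq L /\ sorted (tadj T) L.

(* Graph distance; the junk value is #|V| when [v] is not reachable from [u]. *)
Definition gdist e (u v : V) : nat :=
  find (fun k => [exists p : k.-tuple V, path e u p && (last u p == v)])
       (iota 0 #|V|).

Definition off_adj T L : rel V :=
  [rel u v | [&& tadj T u v, u \notin L & v \notin L]].

Definition component_off T L B : Prop :=
  exists2 v, v \notin L & B = [set w | connect (off_adj T L) v w]%SET.

(* The branch off [L] with vertex set [B] together with its attachment vertex
   [a]; [a] is determined by [B] when [T] is a spanning tree and [L] a path
   in [T]. *)
Definition is_branch T L B (a : V) : Prop :=
  [/\ component_off T L B, a \in L & exists2 v, v \in B & tadj T v a].

Definition branch_length T B (a : V) : nat :=
  \max_(v in B) gdist (tadj T) v a.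

Definition has_branch_ge T L (l : nat) : Prop :=
  exists B a, is_branch T L B a /\ l <= branch_length T B a.

End Graphs.

Section LoopErasure.
Variable V : finType.

(* The path is read from left to right, keeping the loop-erasure [s] of the
   part read so far; when [x] closes a loop, that loop is cut from [s]. *)
Definition le_step (s : seq V) (x : V) : seq V :=
  if x \in s then take (index x s).+1 s else rcons s x.

Definition loop_erasure (p : seq V) : seq V := foldl le_step [::] p.

Definition path_edges (p : seq V) : {set {set V}} :=
  [set:: [seq [set q.1; q.2]%SET | q <- zip p (behead p)]]%SET.

End LoopErasure.

Section Wilson.
Variable V : finType.

(* The walk [w] up to its first visit of [U], endpoints included;
   [None] if [w] never visits [U]. *)
Definition walk_until (w : nat -> V) (U : {set V}) : option (seq V) :=
  match pselect (exists t, w t \in U) with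
  | left h => Some (mkseq w (ex_minn h).+1)
  | right _ => None
  end.

(* [X v] is the trajectory used if a walk has to be started from [v]; each
   vertex is the starting point of at most one walk.  [U] is the vertex set of
   the current tree.  The result lists the loop-erased paths in the order in
   which they are added. *)
Fixpoint wilson_paths (X : V -> nat -> V) (ord : seq V) (U : {set V}) :
    option (seq (seq V)) :=
  match ord with
  | [::] => Some [::]
  | v :: ord' =>
      if v \in U then wilson_paths X ord' U
      else if walk_until (X v) U is Some w then
        let p := loop_erasure w in
        omap (cons p) (wilson_paths X ord' (U :|: [set:: p])%SET)
      else None
  end.

(* First loop-erased path and edge set of the final tree, for the root [r] and
   the ordering [ord] of the other vertices; [None] if some walk never hits the
   current tree. *)
Definition wilson (X : V -> nat -> V) (r : V) (ord : seq V) :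
    option (seq V * {set {set V}}) :=
  omap (fun ps => (head [::] ps, (\bigcup_(p <- ps) path_edges p)%SET))
       (wilson_paths X ord [set r]%SET).

End Wilson.

Section RandomWalks.
Local Open Scope classical_set_scope.
Local Open Scope ring_scope.
Local Open Scope ereal_scope.
Context {R : realType} {d : measure_display} {Omega : measurableType d}.
Variables (P : probability Omega R) (V : finType).

Definition srw_step (e : rel V) (u v : V) : R :=
  if e u v then (#|[pred w | e u w]|%:R)^-1%R else 0%R.

(* Simple random walk on the graph [e] started at [v]; the last clause is the
   Markov property with transition probabilities [srw_step e], written without
   division. *)
Definition is_srw (e : rel V) (v : V) (X : nat -> Omega -> V) : Prop :=
  [/\ forall t x, measurable (X t @^-1` [set x]),
      P (X 0%N @^-1` [set v]) = 1
    & forall (t : nat) (x : nat -> V) (y : V),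
        P [set w | (forall s, (s <= t)%N -> X s w = x s) /\ X t.+1 w = y] =
        P [set w | forall s, (s <= t)%N -> X s w = x s]
          * (srw_step e (x t) y)%:E].

Definition process_sigma (X : nat -> Omega -> V) : set (set Omega) :=
  <<s [set A | exists t x, A = X t @^-1` [set x]] >>.

(* Mutual independence of the sigma-algebras generated by the processes;
   subfamilies are covered by taking [A v = setT]. *)
Definition independent_processes (X : V -> nat -> Omega -> V) : Prop :=
  forall A : V -> set Omega,
    (forall v, process_sigma (X v) (A v)) ->
    P [set w | forall v, A v w] = (\prod_(v : V) fine (P (A v)))%R%:E.

Definition independent_srws (e : rel V) (X : V -> nat -> Omega -> V) : Prop :=
  (forall v, is_srw e v (X v)) /\ independent_processes X.

End RandomWalks.

Section Cylinder.
Local Open Scope ring_scope.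
Variables n m : nat.

(* For [1 < n], ['Z_n] is the ring of integers modulo [n]. *)
Definition cyl : finType := ('Z_n * 'I_m)%type.

Definition cyl_adj : rel cyl := fun u v =>
     (u.2 == v.2) && ((v.1 == u.1 + 1) || (u.1 == v.1 + 1))
  || (u.1 == v.1) && ((v.2 == u.2.+1 :> nat) || (u.2 == v.2.+1 :> nat)).

Definition cyl_ring (k : nat) : {set cyl} := [set v : cyl | v.2 == k :> nat]%SET.

Definition is_trunk (T : {set {set cyl}}) (L : seq cyl) : Prop :=
  simple_path_in T L /\
  forall k, (k < m)%N -> exists2 v, v \in L & v \in cyl_ring k.

End Cylinder.

(* Main.v *)
(* By loop-erasure, the probability that a walk from x in A has loop-erasure
   x, y, ... is G_A(x,x) p(x,y) times the same quantity for A \ x started at y,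
   where G_A is the Green function of the walk killed outside A.  Since
   G_A(x,x) G_{A\x}(y,y) is symmetric in x and y, the product of Green functions
   collected along a run of the algorithm does not depend on the order, so all
   spanning trees, encoded by their parent functions towards the root, are
   equally likely.

   For the tail bound, call a ring j clockwise if the parent of every vertex of
   ring j off the trunk L is its clockwise neighbour.  As L meets every ring,
   redirecting a whole ring clockwise gives again a spanning tree, with the same
   L and the same status of all other rings, and at most 4^n trees have the same
   image.  Hence a given set of h rings contains no clockwise ring with
   probability at most (4^n / (4^n + 1))^h.  The parent path of a vertex off L
   cannot cross a clockwise ring before reaching L, so a branch of length at
   least 2nh forces h consecutive rings without a clockwise one. *)
Require Import Defs.
From mathcomp Require Import all_boot all_order all_algebra.
From mathcomp Require Import all_classical all_reals all_analysis.
From mathcomp Require Import zify lra.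

Set Implicit Arguments.
Unset Strict Implicit.
Unset Printing Implicit Defensive.

Import Order.TTheory GRing.Theory Num.Theory.
Local Open Scope classical_set_scope.
Local Open Scope ring_scope.

(** * Weighted sets of walks *)

Section Esum.
Variable R : realType.
Local Open Scope ereal_scope.

(** The target of each walk of the algorithm depends on the earlier walks, whereas the hypothesis
    gives independence between whole trajectories. Fixing the parent function first removes this
    obstacle: it determines every target set in advance, so the event that the run follows it is an
    intersection of one event per starting vertex, and its probability factorises. Each factor is a
    sum over walks, treated as words, and every identity between such sums is a unique factorisation
    of words. The sums live in [0, +oo], so Green functions must be shown finite before anything is
    cancelled; finiteness comes from the bound 1 on the weight of prefix-free sets and from a walk
    of positive weight to the root. That walks almost surely follow edges and hit their targets is
    proved separately, so that the runs described by parent functions carry all the probability. The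
    tail estimate is then pure counting of parent functions, and the factor m is the number of
    possible positions of a window of consecutive rings. *)

Lemma esumZl (T : choiceType) (D : set T) (k : \bar R) (f : T -> \bar R) :
  0 <= k -> (forall i, 0 <= f i) ->
  \esum_(i in D) (k * f i) = k * \esum_(i in D) f i.
Proof.
move=> k0 f0; case: k k0 => [k | _|]; last by rewrite leeNy_eq.
  rewrite lee_fin le_eqVlt => /predU1P[<-|k0].
    by rewrite mul0e esum1// => i _; rewrite mul0e.
  rewrite /esum -ereal_sup_pZl//; congr ereal_sup.
  apply/seteqP; split=> [_ [A AD <-]|_ [_ [A AD <-] <-]].
    by exists (\sum_(x \in A) f x); [exists A|rewrite ge0_mule_fsumr].
  by exists A => //; rewrite ge0_mule_fsumr.
have [f00|/existsNP[i /not_implyP[Di /eqP fi]]] :=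
    pselect (forall i, D i -> f i = 0).
  by rewrite !esum1 ?mule0// => i Di; rewrite f00// mule0.
have {}fi : 0 < f i by rewrite lt_def fi f0.
have fE (g : T -> \bar R) : (forall i, 0 <= g i) -> g i <= \esum_(i in D) g i.
  move=> g0; apply: (@esum_ge _ _ D); exists [set i]; last by rewrite fsbig_set1.
  by split; [exact: finite_set1|move=> _ ->].
rewrite [RHS]gt0_mulye ?(lt_le_trans fi (fE _ f0))//.
apply/eqP; rewrite -leye_eq -[leLHS](gt0_mulye fi).
by apply: (fE (fun i => +oo * f i)) => j; rewrite mule_ge0.
Qed.
End Esum.

Section WalkWeights.
Variables (R : realType) (V : finType) (st : V -> V -> R).
Hypothesis st_ge0 : forall x y, 0 <= st x y.

(* A walk is given by its starting point [x] and the list [q] of its later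
   positions. *)
Fixpoint wgt (x : V) (q : seq V) : R :=
  if q is y :: q' then st x y * wgt y q' else 1.

Lemma wgt_ge0 x q : 0 <= wgt x q.
Proof. by elim: q x => //= y q IH x; rewrite mulr_ge0. Qed.

Lemma wgt_cat x q1 q2 : wgt x (q1 ++ q2) = wgt x q1 * wgt (last x q1) q2.
Proof. by elim: q1 x => [|y q IH] x /=; rewrite ?mul1r// IH mulrA. Qed.

(** Valued in the extended reals, since the sum may diverge. For the random walk it is the expected
    number of initial segments of the walk from [x] that lie in [S], hence a probability when [S] is
    prefix-free. *)
Definition wt (x : V) (S : set (seq V)) : \bar R :=
  (\esum_(q in S) (wgt x q)%:E)%E.

Lemma wt_ge0 x S : (0 <= wt x S)%E.
Proof. by apply: esum_ge0 => q _; rewrite lee_fin wgt_ge0. Qed.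

Lemma wt1 x q : wt x [set q] = (wgt x q)%:E.
Proof. by rewrite /wt esum_set1 // lee_fin wgt_ge0. Qed.

Definition catset (S1 S2 : set (seq V)) : set (seq V) :=
  [set q | exists q1 q2, [/\ S1 q1, S2 q2 & q = q1 ++ q2]].

(** One cut point per word: factorisations whose first factors have equal size coincide.
    Concatenation is then a bijection from pairs onto [catset S1 S2], which makes weights
    multiplicative. *)
Definition unambiguous (S1 S2 : set (seq V)) :=
  forall a b c d, S1 a -> S1 b -> S2 c -> S2 d ->
    a ++ c = b ++ d -> size a = size b.

Lemma wt_cat x y S1 S2 : (forall q, S1 q -> last x q = y) ->
  unambiguous S1 S2 -> wt x (catset S1 S2) = (wt x S1 * wt y S2)%E.
Proof.
move=> S1y amb.
rewrite /wt (reindex_esum (S1 `*`` (fun=> S2)) _ (fun p => p.1 ++ p.2)).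
  rewrite -(esum_esum (a := fun i j => (wgt x (i ++ j))%:E)); last first.
    by move=> *; rewrite lee_fin wgt_ge0.
  rewrite muleC -esumZl ?wt_ge0//; last by move=> i; rewrite lee_fin wgt_ge0.
  apply: eq_esum => q S1q; rewrite muleC -esumZl ?lee_fin ?wgt_ge0//.
    by apply: eq_esum => q' _; rewrite wgt_cat S1y// EFinM.
  by move=> i; rewrite lee_fin wgt_ge0.
split=> [[a b] /= [Sa Sb]|[a c] [b d] /=|_ [a [b [Sa Sb ->]]]].
- by exists a, b.
- rewrite !inE => -[/= Sa Sc] [/= Sb Sd] E; have ab := amb _ _ _ _ Sa Sb Sc Sd E.
  by move: E => /eqP; rewrite eqseq_cat// => /andP[/eqP -> /eqP ->].
- by exists (a, b).
Qed.

Lemma wtU x S1 S2 : (forall q, S1 q -> ~ S2 q) ->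
  wt x (S1 `|` S2) = (wt x S1 + wt x S2)%E.
Proof.
move=> dis; rewrite /wt (esumID S1); last by move=> *; rewrite lee_fin wgt_ge0.
by congr (_ + _)%E; congr esum; apply/seteqP; split=> q /=; try tauto;
  move=> S2q; split; [right|move/dis].
Qed.

Lemma wtS x S1 S2 : S1 `<=` S2 -> (wt x S1 <= wt x S2)%E.
Proof.
move=> S12; rewrite /wt (esumID S1 S2); last first.
  by move=> *; rewrite lee_fin wgt_ge0.
rewrite (_ : S2 `&` S1 = S1); last by rewrite setIC; apply/setIidPl.
by rewrite leeDl// esum_ge0// => *; rewrite lee_fin wgt_ge0.
Qed.
End WalkWeights.

(** * Walks followed by a simple random walk *)

Section Following.
Context {R : realType} {d : measure_display} {Omega : measurableType d}.
Variables (P : probability Omega R) (V : finType) (e : rel V).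

Lemma srw_step_ge0 x y : 0 <= srw_step e x y :> R.
Proof. by rewrite /srw_step; case: ifP => // _; rewrite invr_ge0 ler0n. Qed.

Definition follow (X : nat -> Omega -> V) (x : V) (q : seq V) : set Omega :=
  [set w | forall i, (i <= size q)%N -> X i w = nth x (x :: q) i].

Definition follows X x (S : set (seq V)) : set Omega :=
  \bigcup_(q in S) follow X x q.

Lemma process_sigma_follow X x q : process_sigma X (follow X x q).
Proof.
have -> : follow X x q = \bigcap_(i < (size q).+1) (X i @^-1` [set nth x (x :: q) i]).
  by apply/seteqP; split=> w /= H i; exact: H.
apply: (@bigcap_measurable _ (g_sigma_algebraType _)) => [|i _]; first by exists 0%N.
by apply: sub_sigma_algebra; exists i, (nth x (x :: q) i).
Qed.

Lemma process_sigma_bigcup (T : countType) (X : nat -> Omega -> V) (S : set T) (F : T -> set Omega) :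
  (forall q, S q -> process_sigma X (F q)) ->
  process_sigma X (\bigcup_(q in S) F q).
Proof.
move=> SF; rewrite bigcup_mkcond.
apply: (@countable_bigcupT_measurable _ (g_sigma_algebraType _)) => //.
move=> q; case: ifPn => [/set_mem/SF//|_]; exact: (@measurable0 _ (g_sigma_algebraType _)).
Qed.

Lemma process_sigma_follows X x S : process_sigma X (follows X x S).
Proof. by apply: process_sigma_bigcup => q _; exact: process_sigma_follow. Qed.

Lemma process_sigma_measurable (X : nat -> Omega -> V) A :
  (forall t x, measurable (X t @^-1` [set x])) -> process_sigma X A -> measurable A.
Proof.
move=> mX; apply: smallest_sub; first exact: sigma_algebra_measurable.
by move=> _ [t [x ->]].
Qed.

Variables (v : V) (X : nat -> Omega -> V).
Hypothesis srwX : is_srw P e v X.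

Lemma follow_measurable x q : measurable (follow X x q).
Proof.
apply: (process_sigma_measurable (X := X)); last exact: process_sigma_follow.
by case: srwX.
Qed.

Lemma follows_measurable x S : measurable (follows X x S).
Proof.
apply: (process_sigma_measurable (X := X)); last exact: process_sigma_follows.
by case: srwX.
Qed.

Lemma follow_prob q : P (follow X v q) = (wgt (srw_step e) v q)%:E.
Proof.
case: srwX => mX X0 step; elim/last_ind: q => [|q y IH].
  rewrite -X0; congr (P _); apply/seteqP; split=> w /= H; first exact: (H 0%N).
  by case.
have := step (size q) (fun s => nth v (v :: q) s) y.
rewrite (_ : [set w | _] = follow X v (rcons q y)).
  move=> ->; rewrite IH -cats1 wgt_cat/= mulr1 EFinM; congr (_ * (srw_step e _ _)%:E)%E.
  by rewrite -last_nth.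
apply/seteqP; split=> w /=; last first.
  move=> H; split; last by rewrite H ?size_rcons//= nth_rcons ltnn eqxx.
  move=> i iq; rewrite H ?size_rcons ?(leq_trans iq)//.
  by case: i iq => //= i iq; rewrite nth_rcons iq.
move=> [H1 H2] i; rewrite size_rcons leq_eqVlt => /predU1P[->|].
  by rewrite H2 /= nth_rcons ltnn eqxx.
by case: i => [|i] iq; rewrite H1//= nth_rcons (iq : (i < size q)%N).
Qed.

Definition prefix_free (S : set (seq V)) :=
  forall a b, S a -> S (a ++ b) -> b = [::].

Lemma follow_prefix x a b w :
  follow X x a w -> follow X x b w -> (size a <= size b)%N ->
  b = a ++ drop (size a) b.
Proof.
move=> fa fb ab; rewrite -[LHS](cat_take_drop (size a)); congr cat.
apply: (@eq_from_nth _ x); rewrite size_takel// => i ia.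
by have := fb i.+1 (leq_trans ia ab); rewrite (fa i.+1)//= nth_take.
Qed.

Lemma prefix_free_follow x S a b w : prefix_free S -> S a -> S b ->
  follow X x a w -> follow X x b w -> a = b.
Proof.
move=> pf; wlog ab : a b / (size a <= size b)%N.
  by move=> H Sa Sb fa fb; case/orP: (leq_total (size a) (size b)) => ?;
    [|symmetry]; apply: H.
move=> Sa Sb fa fb; have := follow_prefix fa fb ab => bE.
by move: (Sb); rewrite bE => /(pf _ _ Sa) ->; rewrite cats0.
Qed.

(** Two words followed by the same trajectory are comparable as prefixes, hence equal if both lie in
    a prefix-free set; so the events are disjoint and their probabilities add up. *)
Lemma follows_prob S : prefix_free S ->
  P (follows X v S) = wt (srw_step e) v S.
Proof.
move=> pf; rewrite /follows.
(* Words are re-indexed by natural numbers through [pickle], so that countable additivity over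
   sequences applies. *)
pose F k := if unpickle k is Some q then follow X v q else set0.
have FE q : F (pickle q) = follow X v q by rewrite /F pickleK.
have -> : \bigcup_(q in S) follow X v q = \bigcup_(k in pickle @` S) F k.
  apply/seteqP; split=> w; first by move=> [q Sq fq]; exists (pickle q); rewrite ?FE//; exists q.
  by move=> [_ [q Sq <-]]; rewrite FE => fq; exists q.
rewrite measure_bigcup.
- rewrite nneseries_esum; last by move=> *; exact: measure_ge0.
  rewrite set_mem_set /wt esum_image; last by move=> a b _ _ /(pcan_inj pickleK).
  by apply: eq_esum => q Sq; rewrite FE; exact: follow_prob.
- by move=> _ [q Sq <-]; rewrite FE; exact: follow_measurable.
- move=> _ _ [a Sa <-] [b Sb <-]; rewrite !FE => -[w [fa fb]].
  by rewrite (prefix_free_follow pf Sa Sb fa fb).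
Qed.

(** The existence of the random walk enters the theory of Green functions through this bound, which
    is taken there as a hypothesis on the step weights. *)
Lemma wt_prefix_free_le1 S : prefix_free S ->
  (wt (srw_step (R := R) e) v S <= 1)%E.
Proof.
move=> /follows_prob <-. apply: probability_le1. exact: follows_measurable.
Qed.
End Following.

(** * Green functions *)

Lemma split_first (T : eqType) (y : T) q : y \in q ->
  exists a b, q = rcons a y ++ b /\ y \notin a.
Proof.
elim: q => //= z q IH; have [-> _|yz] := eqVneq z y; first by exists [::], q.
rewrite inE eq_sym (negPf yz)/= => /IH[a [b [-> ya]]].
by exists (z :: a), b; rewrite inE eq_sym negb_or yz.
Qed.

Lemma split_last (T : eqType) (y : T) q : y \in q ->
  exists a b, q = rcons a y ++ b /\ y \notin b.
Proof.
move=> yq; have [|a [b [E yb]]] := @split_first _ y (rev q); first by rewrite mem_rev.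
exists (rev b), (rev a); rewrite mem_rev; split=> //.
by rewrite -[q]revK E rev_cat rev_rcons cat_rcons.
Qed.

Lemma split_exit (T : eqType) (p : pred T) q : ~~ all p q ->
  exists a z b, [/\ q = rcons a z ++ b, all p a & ~~ p z].
Proof.
elim: q => //= z q IH; have [pz /IH[a [y [b [-> pa py]]]]|pz _] := boolP (p z).
  by exists (z :: a), y, b; rewrite /= pz.
by exists [::], z, q.
Qed.

Section Green.
Variables (R : realType) (V : finType) (st : V -> V -> R) (r : V).
Hypothesis st_ge0 : forall x y, 0 <= st x y.
Hypothesis prefix_free_le1 : forall x S, prefix_free S -> (wt st x S <= 1)%E.
Hypothesis reach_root : forall x, exists2 q, 0 < wgt st x q & last x q = r.
Implicit Types (A : {set V}) (x y : V) (q : seq V).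

Definition walks A x y : set (seq V) := [set q | all (mem A) q /\ last x q = y].

(** Walks stopped at their first visit of [y] at a positive time, inside [A] until then; their
    weight is a first-passage probability. *)
Definition firsts A y : set (seq V) :=
  [set q | exists2 q', q = rcons q' y & all (mem (A :\ y)%SET) q'].

Definition exits A : set (seq V) :=
  [set q | exists q' z, [/\ q = rcons q' z, all (mem A) q' & z \notin A]].

(** The expected number of visits to [y] of the walk from [x] killed on leaving [A]; the empty word
    counts the visit at time 0 when [x] is [y]. *)
Definition green A x y : \bar R := wt st x (walks A x y).

Lemma all_setD1 A y q : all (mem (A :\ y)%SET) q = (all (mem A) q && (y \notin q)).
Proof.
by elim: q => //= z q ->; rewrite in_setD1 inE negb_or eq_sym; 
  case: (y != z); case: (z \in A); case: (all _ _).
Qed.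

Lemma prefix_free_firsts A y : prefix_free (firsts A y).
Proof.
move=> a b [a' -> _] [c E]; rewrite all_setD1 => /andP[_ yc].
case/lastP: b E => // b z; rewrite -rcons_cat => /rcons_inj[E _].
by move: yc; rewrite -E mem_cat mem_rcons inE eqxx.
Qed.

Lemma prefix_free_exits A : prefix_free (exits A).
Proof.
move=> a b [a' [z [-> _ zA]]] [c [u [E cA _]]].
case/lastP: b E => // b t; rewrite -rcons_cat => /rcons_inj[E _].
by move: cA; rewrite -E all_cat all_rcons /= (negPf zA).
Qed.

Lemma unambiguous_firsts A y S : unambiguous (firsts A y) S.
Proof.
move=> _ _ c d [a' ->] + [b' ->] +; rewrite !all_setD1.
move=> /andP[_ ya] /andP[_ yb] Sc Sd E; have := congr1 (index y) E.
by rewrite !cat_rcons !index_cat (negPf ya) (negPf yb)/= eqxx !addn0 !size_rcons => ->.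
Qed.

(** The strong Markov property at the first visit of [y], in the form of a unique factorisation of
    words. *)
Lemma green_first A x y : x != y -> y \in A ->
  green A x y = (wt st x (firsts A y) * green A y y)%E.
Proof.
move=> xy yA; rewrite /green -(@wt_cat _ _ _ _ _ y); first last.
- exact: unambiguous_firsts.
- by move=> _ [a -> _]; rewrite last_rcons.
- exact: st_ge0.
congr wt; apply/seteqP; split=> q.
  move=> [qA lq]; have yq : y \in q.
    by have := mem_last x q; rewrite lq inE eq_sym (negPf xy).
  have [a [b [qE ya]]] := split_first yq; move: qA lq; rewrite qE all_cat last_cat last_rcons.
  move=> /andP[aA bA] lb; exists (rcons a y), b; split=> //; exists a => //.
  by move: aA; rewrite all_setD1 ya all_rcons => /andP[_ ->].
move=> [_ [b [[a ->]]]]; rewrite all_setD1 => /andP[aA _] [bA lb] ->.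
by split; rewrite ?last_cat ?last_rcons// all_cat all_rcons bA aA/= yA.
Qed.

(* Walks from [y] to [y] are split at their first visit of [x], if any. *)
Lemma green_avoid A x y : x != y -> x \in A ->
  green A y y = (green (A :\ x)%SET y y + wt st y (firsts A x) * green A x y)%E.
Proof.
move=> xy xA; rewrite /green -(@wt_cat _ _ _ _ _ x); first last.
- exact: unambiguous_firsts.
- by move=> _ [a -> _]; rewrite last_rcons.
- exact: st_ge0.
rewrite -wtU //; last first.
  move=> q [+ _] [_ [b [[a -> _] _ qE]]]; rewrite all_setD1 qE.
  by rewrite mem_cat mem_rcons inE eqxx andbF.
congr wt; apply/seteqP; split=> q.
  move=> [qA lq]; have [xq|xq] := boolP (x \in q); last by left; split; rewrite // all_setD1 qA.
  have [a [b [qE ya]]] := split_first xq; move: qA lq; rewrite qE all_cat last_cat last_rcons.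
  move=> /andP[aA bA] lb; right; exists (rcons a x), b; split=> //; exists a => //.
  by move: aA; rewrite all_setD1 ya all_rcons => /andP[_ ->].
case=> [[]|]; first by rewrite all_setD1 => /andP[].
move=> [_ [b [[a ->]]]]; rewrite all_setD1 => /andP[aA _] [bA lb] ->.
by split; rewrite ?last_cat ?last_rcons// all_cat all_rcons bA aA/= xA.
Qed.

(** A walk to [r] must leave [A]; cut at its exit it has a positive weight p. Loops at [x] inside
    [A] followed by this fixed exit form a prefix-free set, so the Green function times p is at most
    1. *)
Lemma green_diag_fin A x : r \notin A -> x \in A -> green A x x \is a fin_num.
Proof.
move=> rA xA; have [q q0 lq] := reach_root x.
have /split_exit[a [z [b [qE aA zA]]]] : ~~ all (mem A) q.
  apply: contra rA => qA; rewrite -lq; case: q {q0 lq} qA => //= y q.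
  by move=> /andP[yA qA]; have := mem_last y q; rewrite inE => /predU1P[->//|]; exact: (allP qA).
have {}zA : z \notin A by [].
have {}q0 : 0 < wgt st x (rcons a z).
  rewrite lt_def wgt_ge0// andbT; apply: contraTneq q0.
  by rewrite qE wgt_cat => ->; rewrite mul0r ltxx.
have : (green A x x * (wgt st x (rcons a z))%:E <= 1)%E.
  rewrite -wt1// -wt_cat//; first last.
  - move=> c d _ _ _ _ -> -> /(congr1 size); rewrite !size_cat.
    by move=> /eqP; rewrite eqn_add2r => /eqP.
  - by move=> ? [].
  apply: prefix_free_le1 => c d [c1 [_ [[c1A _] -> ->]]] [c2 [_ [[c2A _] ->]]].
  case/lastP: d => // d t; rewrite -!rcons_cat => /rcons_inj[E _].
  have : all (mem A) (c2 ++ a) by rewrite all_cat c2A.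
  by rewrite -E all_cat all_rcons /= (negPf zA).
rewrite ge0_fin_numE ?wt_ge0// ltey; apply: contraTneq => ->.
by rewrite gt0_mulye ?lte_fin.
Qed.

Lemma green_fin A x y : r \notin A -> y \in A -> green A x y \is a fin_num.
Proof.
move=> rA yA; have [->|xy] := eqVneq x y; first exact: green_diag_fin.
rewrite green_first// fin_numM ?green_diag_fin// ge0_fin_numE ?wt_ge0//.
by rewrite (le_lt_trans (prefix_free_le1 _ _)) ?ltry//; exact: prefix_free_firsts.
Qed.

(** Combining the splittings at first visits, G_A(x,x) G_A(y,y) exceeds either side by G_A(x,y)
    G_A(y,x). This excess is symmetric in [x] and [y], and finite, so it can be cancelled. *)
Lemma green_swap A x y : r \notin A -> x \in A -> y \in A ->
  (green A x x * green (A :\ x)%SET y y = green A y y * green (A :\ y)%SET x x)%E.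
Proof.
move=> rA xA yA; have [->//|xy] := eqVneq x y.
have main u v : u != v -> u \in A -> v \in A ->
    (green A u u * green A v v =
     green A u u * green (A :\ u)%SET v v + green A v u * green A u v)%E.
  move=> uv uA vA; rewrite (green_avoid uv uA) (green_first (x := v) _ uA) 1?eq_sym//.
  rewrite ge0_muleDr ?wt_ge0//; last by rewrite mule_ge0 ?wt_ge0.
  by congr (_ + _)%E; rewrite muleCA muleA.
have yx : y != x by rewrite eq_sym.
have := main _ _ yx yA xA; rewrite muleC (main _ _ xy xA yA) [(green A y x * _)%E]muleC.
have fxy : (green A x y * green A y x)%E \is a fin_num by rewrite fin_numM ?green_fin.
by move/(congr1 (fun t => t - green A x y * green A y x)%E); rewrite !addeK.
Qed.
End Green.

(** * The law of the loop-erasure *)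

Section LoopErasureFacts.
Variable V : finType.
Implicit Types (x y : V) (s q : seq V).

Lemma foldl_le_step_notin x s q : x \notin q ->
  foldl (@le_step V) (x :: s) q = x :: foldl (@le_step V) s q.
Proof.
elim: q s => //= y q IH s; rewrite inE negb_or => /andP[xy xq].
rewrite -IH//; congr foldl; rewrite /le_step/= inE eq_sym (negPf xy)/=.
by case: ifP.
Qed.

Lemma foldl_le_step_head x s q :
  exists s', foldl (@le_step V) (x :: s) q = x :: s'.
Proof.
elim: q s => [|y q IH] s; first by exists s.
by rewrite /= /le_step; case: ifP => _ /=; [case: ifP => _|]; exact: IH.
Qed.

Lemma le_step_head x s : le_step (x :: s) x = [:: x].
Proof. by rewrite /le_step/= inE eqxx/= take0. Qed.

(** Returning to [x], the first vertex kept, erases everything since; as [q2] avoids [x], it is then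
    processed undisturbed behind it. *)
Lemma loop_erasure_loop x q1 q2 : last x q1 = x -> x \notin q2 ->
  loop_erasure (x :: q1 ++ q2) = x :: loop_erasure q2.
Proof.
move=> lq xq2; rewrite /loop_erasure/= foldl_cat -foldl_le_step_notin//; congr foldl.
have -> : le_step [::] x = [:: x] by [].
case/lastP: q1 lq => // q1 y; rewrite last_rcons => ->.
have [s' E] := foldl_le_step_head x [::] q1.
by rewrite foldl_rcons E le_step_head.
Qed.

Lemma loop_erasure_cons x q : exists s, loop_erasure (x :: q) = x :: s.
Proof. exact: foldl_le_step_head. Qed.

Lemma last_loop_erasure x q : last x (loop_erasure q) = last x q.
Proof.
case/lastP: q => // q y; rewrite /loop_erasure foldl_rcons /le_step last_rcons.
case: ifP => yq; last by rewrite last_rcons.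
by rewrite (take_nth y) ?index_mem// last_rcons nth_index.
Qed.

Lemma mem_loop_erasure q : {subset loop_erasure q <= q}.
Proof.
elim/last_ind: q => // q y IH z; rewrite /loop_erasure foldl_rcons /le_step mem_rcons inE.
by case: ifP => _; [move=> /mem_take/IH->|rewrite mem_rcons inE => /predU1P[->|/IH->]];
  rewrite ?eqxx ?orbT.
Qed.

Lemma uniq_loop_erasure q : uniq (loop_erasure q).
Proof.
elim/last_ind: q => // q y IH; rewrite /loop_erasure foldl_rcons /le_step.
case: ifP => yq; first exact: take_uniq.
by rewrite rcons_uniq yq IH.
Qed.

Lemma path_loop_erasure (e : rel V) x q : path e x q ->
  sorted e (loop_erasure (x :: q)).
Proof.
elim/last_ind: q => // q y IH; rewrite rcons_path => /andP[/IH pq exy].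
rewrite -rcons_cons /loop_erasure foldl_rcons /le_step; case: ifP => yq.
  exact: take_sorted.
have lE := last_loop_erasure x (x :: q); rewrite -/(loop_erasure (x :: q)).
have [s E] := loop_erasure_cons x q; rewrite E /= in pq lE *.
by rewrite rcons_path pq lE.
Qed.
End LoopErasureFacts.

Section ErasedWeight.
Variables (R : realType) (V : finType) (st : V -> V -> R) (r : V).
Hypothesis st_ge0 : forall x y, 0 <= st x y.
Hypothesis prefix_free_le1 : forall x S, prefix_free S -> (wt st x S <= 1)%E.
Hypothesis reach_root : forall x, exists2 q, 0 < wgt st x q & last x q = r.
Implicit Types (A : {set V}) (x y : V) (q : seq V).

Definition erased A x g : set (seq V) :=
  exits A `&` [set q | loop_erasure (x :: q) = x :: g].

Definition consset y (S : set (seq V)) : set (seq V) := [set y :: q | q in S].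

Lemma erased_setD1_notin A x y g q : x \notin y :: g ->
  erased (A :\ x)%SET y g q -> x \notin y :: q.
Proof.
move=> xg [[q' [z [-> + zA]]] /= LE]; rewrite all_setD1 => /andP[q'A xq'].
have lz : last y g = z.
  by have := last_loop_erasure y (y :: rcons q' z); rewrite LE/= last_rcons.
have xz : x != z by apply: contraNneq xg => ->; rewrite -lz mem_last.
by move: xg; rewrite !inE mem_rcons inE !negb_or xz xq' => /andP[->].
Qed.

(* Split a walk at its last visit of [x]: what precedes is an arbitrary loop,
   and the loop-erasure only sees what follows. *)
Lemma erased_decomp A x y g : x \in A -> x \notin y :: g ->
  erased A x (y :: g) =
  catset (walks A x x)
    (if y \in A then consset y (erased (A :\ x)%SET y g) else [set q | q = [:: y] /\ g = [::]]).
Proof.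
move=> xA xg; apply/seteqP; split=> q.
  move=> [[q' [z [qE q'A zA]]] LE].
  have [q1 [q2 [qE' lq1 xq2]]] : exists q1 q2, [/\ q = q1 ++ q2, last x q1 = x & x \notin q2].
    have [/split_last[a [b [qE' xb]]]|xq] := boolP (x \in q).
      by exists (rcons a x), b; rewrite last_rcons.
    by exists [::], q.
  have xz : x != z by apply: contraNneq zA => <-.
  case/lastP: q2 qE' xq2 => [|q2 z']; first (rewrite cats0 => qE' _).
    by move: lq1; rewrite -qE' qE last_rcons => zx; rewrite zx eqxx in xz.
  rewrite -rcons_cat qE => /rcons_inj[q'E <-] xq2.
  move: q'A; rewrite q'E all_cat => /andP[q1A q2A].
  exists q1, (rcons q2 z); split; rewrite ?rcons_cat -?q'E//.
  have {}LE : loop_erasure (x :: q) = x :: y :: g := LE.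
  move: LE; rewrite qE q'E rcons_cat loop_erasure_loop// => -[LE].
  have yE : y = head z q2.
    by case: q2 LE {q'E xq2 q2A} => [|t q2];
      [|rewrite rcons_cons; case: (loop_erasure_cons t (rcons q2 z)) => s ->] => -[].
  case: q2 {q'E} q2A xq2 LE yE => [|t q2] /=.
    by move=> _ _ [_ <-] ->; rewrite (negPf zA).
  move=> /andP[tA q2A]; rewrite inE negb_or => /andP[xt xq2] LE yt; rewrite yt tA.
  exists (rcons q2 z); rewrite ?yt//; split; last by rewrite /= LE yt.
  exists q2, z; split=> //; last by rewrite in_setD1 (negPf zA) andbF.
  by rewrite all_setD1 q2A; move: xq2; rewrite mem_rcons inE negb_or => /andP[].
move=> [q1 [q2 [[q1A lq1] + ->]]]; case: ifPn => yA.
  move=> [q3 [E LE] <-].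
  have xq := erased_setD1_notin xg (conj E LE).
  split; last by apply: etrans (loop_erasure_loop lq1 xq) _; rewrite LE.
  have [q' [z [q3E + zA]]] := E; rewrite all_setD1 => /andP[q'A _].
  exists (q1 ++ y :: q'), z; rewrite q3E -rcons_cons -rcons_cat; split=> //.
    by rewrite all_cat q1A/= yA.
  move: zA; rewrite in_setD1; case: eqP => // zx; move: xq.
  by rewrite q3E zx inE mem_rcons mem_head orbT.
move=> [-> g0]; rewrite g0 in xg *; split; last exact: etrans (loop_erasure_loop lq1 xg) _.
by exists q1, y; rewrite cats1.
Qed.

(** The first factor ends at [x] and the second avoids it, so the cut can only be at the last visit
    of [x]. *)
Lemma unambiguous_walks A x S : (forall q, S q -> x \notin q) ->
  unambiguous (walks A x x) S.
Proof.
move=> xS; have sub a b c d : last x a = x -> x \notin d -> a ++ c = b ++ d -> (size a <= size b)%N.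
  move=> la xd E; rewrite leqNgt; apply/negP => ba; move/negP: xd; apply.
  have bE : a = b ++ take (size a - size b) d.
    have /(congr1 (take (size a))) := E; rewrite take_size_cat// => aE.
    by rewrite {1}aE take_cat ltnNge (ltnW ba).
  have sub_t := @mem_take (size a - size b) _ d; move: (take _ d) bE sub_t => t bE sub_t.
  apply: sub_t; move: la ba; rewrite bE last_cat; case: t {bE} => [|u t] /= <-.
    by rewrite cats0 ltnn.
  by rewrite mem_last.
move=> a b c d [_ la] [_ lb] /xS xc /xS xd E; apply/eqP.
by rewrite eqn_leq (sub a b c d)// (sub b a d c).
Qed.

Lemma wt_consset x y S : wt st x (consset y S) = ((st x y)%:E * wt st y S)%E.
Proof.
rewrite -[(st x y)%:E](_ : wt st x [set [:: y]] = _)%E; last by rewrite wt1//= mulr1.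
rewrite -(@wt_cat _ _ _ _ _ y)//; last 2 first.
- by move=> _ ->.
- by move=> _ _ ? ? -> ->.
congr wt; apply/seteqP; split=> [_ [q Sq <-]|_ [_ [q [-> Sq ->]]]].
  by exists [:: y], q.
by exists q.
Qed.

Lemma wt_erased A x y g : x \in A -> x \notin y :: g ->
  wt st x (erased A x (y :: g)) =
  (green st A x x * (st x y)%:E *
   (if y \in A then wt st y (erased (A :\ x)%SET y g) else (g == [::])%:R%:E))%E.
Proof.
move=> xA xg; rewrite erased_decomp//.
rewrite (@wt_cat _ _ _ _ _ x)//; first last.
- apply: unambiguous_walks => q; case: ifP => _; last first.
    by move=> [-> _]; move: xg; rewrite !inE negb_or => /andP[].
  by move=> [q' Eq' <-]; exact: erased_setD1_notin Eq'.
- by move=> q [].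
rewrite -muleA; congr (_ * _)%E; case: ifP => yA; first by rewrite wt_consset.
case: eqP => [->|g0].
  rewrite mule1 (_ : [set _ | _] = [set [:: y]]) ?wt1//= ?mulr1//.
  by apply/seteqP; split=> q [].
by rewrite mule0 (_ : [set _ | _] = set0) ?/wt ?esum_set0//; apply/seteqP; split=> q [].
Qed.
End ErasedWeight.

(** * The order-independent product of Green functions *)

Section GreenProduct.
Variables (R : realType) (V : finType) (st : V -> V -> R) (r : V).
Hypothesis st_ge0 : forall x y, 0 <= st x y.
Hypothesis prefix_free_le1 : forall x S, prefix_free S -> (wt st x S <= 1)%E.
Hypothesis reach_root : forall x, exists2 q, 0 < wgt st x q & last x q = r.
Implicit Types (A : {set V}) (x y : V) (q : seq V).

(** The determinant of the Green matrix of [A], as a product of diagonal entries while vertices are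
    removed one by one. The number [k] is fuel, and [pick] fixes some order of removal. *)
Fixpoint green_prod_rec k A : R :=
  if k is k'.+1 then
    if [pick x in A] is Some x then
      fine (green st A x x) * green_prod_rec k' (A :\ x)%SET else 1
  else 1.

Definition green_prod A := green_prod_rec #|A| A.

Lemma green_prod0 : green_prod finset.set0 = 1.
Proof. by rewrite /green_prod cards0. Qed.

(** If the recursion picks [y] different from [x], the induction hypothesis removes [x] second after
    [y], and also [y] second after [x]; [green_swap] identifies the two products. *)
Lemma green_prodD1 A x : r \notin A -> x \in A ->
  green_prod A = fine (green st A x x) * green_prod (A :\ x)%SET.
Proof.
move: {2}#|A| (leqnn #|A|) => k; elim: k A x => [|k IH] A x Ak rA xA.
  by move: Ak xA; rewrite leqn0 cards_eq0 => /eqP ->; rewrite inE.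
have cA z : z \in A -> #|A| = #|(A :\ z)%SET|.+1 by move=> zA; rewrite (cardsD1 z) zA.
have rAD z : r \notin (A :\ z)%SET by rewrite in_setD1 negb_and rA orbT.
have [y yA ->] : exists2 y, y \in A &
    green_prod A = fine (green st A y y) * green_prod (A :\ y)%SET.
  rewrite {1}/green_prod (cA x xA)/=; case: pickP => [y yA|/(_ x)]; last by rewrite xA.
  by exists y => //; rewrite /green_prod; congr (_ * green_prod_rec _ _); apply: succn_inj; rewrite -!cA.
have [->//|xy] := eqVneq x y.
have yAx : y \in (A :\ x)%SET by rewrite in_setD1 eq_sym xy.
have xAy : x \in (A :\ y)%SET by rewrite in_setD1 xy.
rewrite (IH (A :\ y)%SET x)// 1?(IH (A :\ x)%SET y)//; last 2 first.
- by rewrite -ltnS -cA.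
- by rewrite -ltnS -cA.
rewrite !mulrA -!fineM ?green_diag_fin ?fin_numM// ?(@green_diag_fin _ _ _ r)//.
rewrite (@green_swap _ _ _ r)//; congr (_ * green_prod _).
by apply/setP => z; rewrite !in_setD1 andbCA.
Qed.

(** The value to be established for the probability that the algorithm, with current tree the
    complement of [A], gives the vertices of [A] their parents [pi]. *)
Definition tree_weight (pi : V -> V) A := green_prod A * \prod_(u in A) st u (pi u).

Lemma tree_weightD1 pi A x : r \notin A -> x \in A ->
  tree_weight pi A = fine (green st A x x) * st x (pi x) * tree_weight pi (A :\ x)%SET.
Proof.
move=> rA xA; rewrite /tree_weight (green_prodD1 rA xA) (big_setD1 x)//=.
by rewrite -!mulrA; congr (_ * _); rewrite mulrCA.
Qed.

(** Each vertex of the path contributes the same factor to the law of the loop-erasure and to the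
    tree weight, so the weights telescope. The product form avoids dividing by a tree weight. *)
Lemma wt_erased_tree pi A x g : r \notin A -> x \in A ->
  path (frel pi) x g -> uniq (x :: g) -> all (mem A) (belast x g) ->
  last x g \notin A ->
  (wt st x (erased A x g) * (tree_weight pi (A :\: [set z in x :: g])%SET)%:E)%E =
  (tree_weight pi A)%:E.
Proof.
elim: g A x => [|y g IH] A x rA xA; first by move=> _ _ _; rewrite /= xA.
rewrite [path _ _ _]/= => /andP[/eqP <- pg] /andP[xg ug] /= /andP[_ gA] lA.
rewrite wt_erased// (tree_weightD1 pi rA xA) !EFinM fineK ?(@green_diag_fin _ _ _ r)//.
rewrite -!muleA; congr (_ * (_ * _))%E.
have AE : (A :\: [set z in x :: pi x :: g] = A :\ x :\: [set z in pi x :: g])%SET.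
  by apply/setP => z; rewrite !inE; case: (z == x); rewrite /= ?andbF.
case: ifP => yA.
  rewrite AE IH//.
  - by rewrite in_setD1 negb_and rA orbT.
  - by rewrite in_setD1 yA andbT; move: xg; rewrite inE negb_or eq_sym => /andP[].
  - by rewrite all_setD1 gA; apply: contra xg => /mem_belast.
  - by rewrite in_setD1 negb_and lA orbT.
case: g gA {IH pg ug lA xg} AE => [_|z g /=]; last by rewrite yA.
rewrite eqxx mul1e => ->; congr (tree_weight _ _)%:E.
by apply/setP => z; rewrite !inE; case: eqP => // ->; rewrite yA andbF.
Qed.
End GreenProduct.

(** * Wilson's algorithm on parent functions *)

Lemma belast_traject (T : Type) (f : T -> T) x k :
  belast x (traject f (f x) k) = traject f x k.
Proof. by elim: k x => //= k IH x; rewrite IH. Qed.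

Section ParentFunctions.
Variables (V : finType) (e : rel V) (r : V).
Implicit Types (pi : {ffun V -> V}) (U : {set V}) (u v : V) (ord : seq V).

Definition rooted pi :=
  [&& pi r == r, [forall v, (v != r) ==> e v (pi v)] & [forall v, fconnect pi v r]].

(* The parent path from [v] to its first vertex in [U], without [v].  For a
   rooted [pi] and [r \in U] that vertex occurs among the first [#|V|] iterates,
   so [find] is not the junk value. *)
Definition climb pi U v : seq V :=
  traject pi (pi v) (find (mem U) (traject pi v #|V|)).

Lemma uniq_first_hit pi U v k : iter k pi v \in U ->
  (forall i, (i < k)%N -> iter i pi v \notin U) -> uniq (traject pi v k.+1).
Proof.
move=> kU iU; rewrite looping_uniq; apply/negP => /loopingP/(_ k)/trajectP[i ik E].
by move: kU; rewrite E (negPf (iU _ ik)).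
Qed.

Lemma climb_first_hit pi U v k : iter k pi v \in U ->
  (forall i, (i < k)%N -> iter i pi v \notin U) ->
  climb pi U v = traject pi (pi v) k.
Proof.
move=> kU iU; have := uniq_first_hit kU iU => /card_uniqP.
rewrite size_traject => cV; have {cV}kV : (k < #|V|)%N by rewrite -cV max_card.
rewrite /climb; congr traject; apply/eqP; rewrite eqn_leq; apply/andP; split.
  rewrite leqNgt; apply/negP => kf; have := before_find v kf.
  by rewrite nth_traject//= kU.
rewrite leqNgt; apply/negP => fk.
have hasU : has (mem U) (traject pi v #|V|).
  by rewrite has_find size_traject (ltn_trans fk).
have := nth_find v hasU; rewrite nth_traject ?(ltn_trans fk)//=.
by rewrite (negPf (iU _ fk)).
Qed.

Lemma climb_path pi U v g : path (frel pi) v g -> all (predC (mem U)) (belast v g) ->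
  last v g \in U -> climb pi U v = g.
Proof.
move=> /fpathP[k ->] gU; rewrite last_traject => kU; apply: climb_first_hit => // i ik.
have := allP gU (iter i pi v); apply; rewrite belast_traject.
by apply/trajectP; exists i.
Qed.

Lemma rooted_reach pi v : rooted pi -> exists k, iter k pi v = r.
Proof. by case/and3P=> _ _ /forallP/(_ v)/iter_findex; exists (findex pi v r). Qed.

Lemma climbP pi U v : rooted pi -> r \in U ->
  [/\ path (frel pi) v (climb pi U v), uniq (v :: climb pi U v),
      all (predC (mem U)) (belast v (climb pi U v)) & last v (climb pi U v) \in U].
Proof.
move=> rpi rU; have ex : exists k, iter k pi v \in U.
  by have [k kr] := rooted_reach v rpi; exists k; rewrite kr.
have [k kU kmin] := ex_minnP ex.
have iU i : (i < k)%N -> iter i pi v \notin U.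
  by move=> ik; apply/negP => /kmin; rewrite leqNgt ik.
rewrite (climb_first_hit kU iU); split; first by apply/fpathP; exists k.
- exact: (uniq_first_hit kU iU).
- by rewrite belast_traject; apply/allP => _ /trajectP[i ik ->]; exact: iU.
- by rewrite last_traject.
Qed.

Lemma climb0 pi U v : v \in U -> climb pi U v = [::].
Proof. by move=> vU; rewrite (@climb_first_hit _ _ _ 0). Qed.

Lemma climbS pi U v : rooted pi -> r \in U -> v \notin U ->
  climb pi U v = pi v :: climb pi U (pi v).
Proof.
move=> rpi rU vU; have [p _ b l] := climbP (pi v) rpi rU.
by apply: climb_path; rewrite //= ?eqxx// vU b.
Qed.

Fixpoint wpaths pi ord U : seq (seq V) :=
  if ord is v :: ord' then
    if v \in U then wpaths pi ord' U
    else (v :: climb pi U v) :: wpaths pi ord' (U :|: [set z in v :: climb pi U v])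
  else [::].

(* The tree present when a walk is started from a given vertex, [None] if that
   vertex is already in the tree when its turn comes. *)
Fixpoint start_tree pi ord U : V -> option {set V} :=
  if ord is v :: ord' then
    if v \in U then start_tree pi ord' U
    else fun u => if u == v then Some U
                  else start_tree pi ord' (U :|: [set z in v :: climb pi U v]) u
  else fun=> None.

Lemma start_tree_notin pi ord U u : u \notin ord -> start_tree pi ord U u = None.
Proof.
elim: ord U => //= v ord IH U; rewrite inE negb_or => /andP[/negPf uv uo].
by case: ifP => _; rewrite ?uv IH.
Qed.

(** Decouples the run: once [pi] is fixed the target sets are deterministic, and the condition on
    the run becomes one condition per trajectory, to which independence applies. *)
Lemma wilson_paths_start pi ord U (x : V -> nat -> V) : uniq ord ->
  wilson_paths x ord U = Some (wpaths pi ord U) <->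
  forall u U', start_tree pi ord U u = Some U' ->
    omap (@loop_erasure V) (walk_until (x u) U') = Some (u :: climb pi U' u).
Proof.
elim: ord U => [|v ord IH] U; first by split.
move=> /andP[vo uo]; rewrite /=; case: ifPn => vU; first exact: IH.
split.
  case E : (walk_until _ _) => [w|]//=.
  case E2 : (wilson_paths _ _ _) => [ps|]//= -[LE psE] u U'.
  case: eqP => [-> [<-]|_]; first by rewrite E/= LE.
  by move: E2; rewrite LE psE => /(proj1 (IH _ uo)); exact.
move=> H; have := H v U; rewrite eqxx => /(_ erefl).
case E : (walk_until _ _) => [w|]//= [LE]; rewrite LE.
rewrite (proj2 (IH _ uo)) // => u U' uU'; apply: H; case: eqP => [uv|//].
by move: uU'; rewrite uv start_tree_notin.
Qed.
End ParentFunctions.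

Section WalkUntil.
Variable V : finType.
Implicit Types (x : nat -> V) (U : {set V}) (s : seq V).

Lemma walk_until_some x U s : walk_until x U = Some s ->
  exists k, [/\ s = mkseq x k.+1, x k \in U & forall i, (i < k)%N -> x i \notin U].
Proof.
rewrite /walk_until; case: pselect => // h [<-]; case: ex_minnP => k kU kmin.
by exists k; split=> // i ik; apply/negP => /kmin; rewrite leqNgt ik.
Qed.

Lemma walk_until_first x U k : x k \in U -> (forall i, (i < k)%N -> x i \notin U) ->
  walk_until x U = Some (mkseq x k.+1).
Proof.
move=> kU iU; rewrite /walk_until; case: pselect => [h|[]]; last by exists k.
case: ex_minnP => j jU jmin; congr (Some (mkseq _ _.+1)); apply/eqP.
rewrite eqn_leq jmin//= leqNgt; apply/negP => jk.
by move: (iU _ jk); rewrite jU.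
Qed.

Lemma walk_until_none x U : walk_until x U = None -> forall t, x t \notin U.
Proof.
rewrite /walk_until; case: pselect => // h _ t; apply/negP => tU.
by apply: h; exists t.
Qed.

End WalkUntil.

(** * The probability of the run described by a parent function *)

Section WilsonLaw.
Context {R : realType} {d : measure_display} {Omega : measurableType d}.
Variables (P : probability Omega R) (V : finType) (e : rel V) (r : V).
Variable (X : V -> nat -> Omega -> V).

Lemma walk_until_follow (Y : nat -> Omega -> V) w (U : {set V}) v q :
  follow Y v q w -> exits (~: U)%SET q -> v \notin U ->
  walk_until (Y ^~ w) U = Some (v :: q).
Proof.
move=> fq [q' [z [qE q'U zU]]] vU.
have qU : z \in U by move: zU; rewrite finset.in_setC negbK.
have E : mkseq (Y ^~ w) (size q).+1 = v :: q.
  apply: (@eq_from_nth _ v); rewrite size_mkseq// => i iq.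
  by rewrite nth_mkseq// fq.
rewrite -E; apply: walk_until_first.
  by rewrite fq// -last_nth qE last_rcons.
move=> i iq; rewrite fq 1?ltnW//; move: iq; rewrite qE size_rcons.
case: i => [//|i] /= iq; rewrite nth_rcons (iq : (i < size q')%N).
by have /(_ _) := allP q'U (nth v q' i); rewrite mem_nth// => /(_ isT); rewrite /= finset.in_setC.
Qed.
Definition erased_event v U s : set Omega :=
  [set w | omap (@loop_erasure V) (walk_until (X v ^~ w) U) = Some s].

(** As soon as one outcome [w0] stops with trajectory [s], following [s] is equivalent to stopping
    with it; so the event is empty or a cylinder event. *)
Lemma process_sigma_walk v U s :
  process_sigma (X v) [set w | walk_until (X v ^~ w) U = Some s].
Proof.
case: s => [|x q].
  rewrite (_ : [set _ | _] = set0); first exact: (@measurable0 _ (g_sigma_algebraType _)).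
  by apply/seteqP; split=> w // /walk_until_some[k []].
have [[w0 w0s]|no] := pselect (exists w0, walk_until (X v ^~ w0) U = Some (x :: q)).
  have [k [E kU iU]] := walk_until_some w0s.
  have sq : size q = k by have := congr1 size E; rewrite size_mkseq => -[].
  rewrite (_ : [set _ | _] = follow (X v) x q); first exact: process_sigma_follow.
  apply/seteqP; split=> w /=.
    move=> /walk_until_some[j [E' _ _]] i iq.
    have sq' : size q = j by have := congr1 size E'; rewrite size_mkseq => -[].
    by rewrite E' nth_mkseq// ltnS -sq'.
  move=> fq; have {}fq i : (i <= k)%N -> X v i w = X v i w0.
    by move=> ik; rewrite fq ?sq// E nth_mkseq.
  rewrite E (walk_until_first (k := k)) ?fq//.
    by congr Some; apply/eq_in_map => i; rewrite mem_iota => /andP[_ ik]; exact: fq.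
  by move=> i ik; rewrite fq ?iU// ltnW.
rewrite (_ : [set _ | _] = set0); first exact: (@measurable0 _ (g_sigma_algebraType _)).
by apply/seteqP; split=> w //= H; apply: no; exists w.
Qed.

Lemma process_sigma_erased v U s : process_sigma (X v) (erased_event v U s).
Proof.
rewrite (_ : erased_event v U s = \bigcup_(t in [set t | loop_erasure t = s])
    [set w | walk_until (X v ^~ w) U = Some t]).
  by apply: process_sigma_bigcup => t _; exact: process_sigma_walk.
apply/seteqP; split=> w /=.
  by rewrite /erased_event/=; case E: walk_until => [t|]//= [<-]; exists t.
by move=> [t <- E]; rewrite /erased_event/= E.
Qed.

Lemma erased_eventE v (U : {set V}) g : v \notin U ->
  erased_event v U (v :: g) = follows (X v) v (erased (~: U)%SET v g).
Proof.
move=> vU; apply/seteqP; split=> w; last first.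
  by move=> [q [qE LE] fq]; rewrite /erased_event/= (walk_until_follow fq qE vU)/= LE.
rewrite /erased_event/=; case E : (walk_until _ _) => [t|//] [LE].
have [k [tE kU iU]] := walk_until_some E.
have [q tq] : exists q, t = X v 0 w :: q by rewrite tE /mkseq /=; eexists.
(* Loop-erasure keeps the first vertex, so the event itself forces the walk to start at [v], with no
   exceptional null set. *)
have X0 : X v 0 w = v.
  by move: LE; rewrite tq; have [s' ->] := loop_erasure_cons (X v 0 w) q => -[].
rewrite X0 in tq.
have k0 : (0 < k)%N by rewrite lt0n; apply: contraNneq vU => k0; rewrite -X0 -k0.
have sq : size q = k by have := congr1 size tE; rewrite tq size_mkseq => -[].
have fq : follow (X v) v q w.
  by move=> i iq; rewrite -tq tE nth_mkseq// ltnS -sq.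
have LEq : loop_erasure (v :: q) = v :: g by rewrite -tq LE.
exists q => //; split; last exact: LEq.
case/lastP: q tq sq fq {LEq} => [_ k0'|q z _ sq fq]; first by rewrite -k0' in k0.
rewrite size_rcons in sq; exists q, z; split=> //.
  apply/allP => _ /(nthP v)[i iq <-]; rewrite /= finset.in_setC.
  have := fq i.+1; rewrite /= nth_rcons iq => <-; last by rewrite size_rcons ltnW.
  by rewrite iU// -sq.
rewrite finset.in_setC negbK; have := fq k; rewrite size_rcons sq => /(_ (leqnn _)) /=.
by rewrite -sq /= nth_rcons ltnn eqxx => <-; rewrite sq.
Qed.

Hypothesis srwX : independent_srws P e X.
Hypothesis er : forall x, connect e x r.

Let st := srw_step (R := R) e.
Let st_ge0 := srw_step_ge0 (R := R) e.

Lemma srw_prefix_free_le1 x S : prefix_free S -> (wt st x S <= 1)%E.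
Proof. exact: (wt_prefix_free_le1 (srwX.1 x)). Qed.

Lemma wgt_path_gt0 x q : path e x q -> 0 < wgt st x q.
Proof.
elim: q x => //= y q IH x /andP[xy /IH]; apply: mulr_gt0.
rewrite /st /srw_step xy invr_gt0 ltr0n; apply/card_gt0P; exists y.
by rewrite inE.
Qed.

Lemma wgt_not_path x q : ~~ path e x q -> wgt st x q = 0.
Proof.
elim: q x => //= y q IH x; rewrite negb_and => /orP[/negPf xy|/IH ->].
  by rewrite /st /srw_step xy mul0r.
by rewrite mulr0.
Qed.

Lemma srw_reach_root x : exists2 q, 0 < wgt st x q & last x q = r.
Proof.
have /connectP[q pq ->] := er x; exists q => //; exact: wgt_path_gt0.
Qed.

Lemma srw_start v : P [set w | X v 0 w != v] = 0.
Proof.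
have [mX X0 _] := srwX.1 v.
have := probability_setC P (mX 0%N v); rewrite X0 subee// => <-; congr (P _).
by apply/seteqP; split=> w /=; [move=> /eqP|move=> ?; apply/eqP].
Qed.

Lemma erased_event_prob pi (U : {set V}) v : rooted e r pi -> r \in U -> v \notin U ->
  (fine (P (erased_event v U (v :: climb pi U v))) *
    tree_weight st pi (~: (U :|: [set z in v :: climb pi U v]))%SET =
  tree_weight st pi (~: U)%SET).
Proof.
move=> rpi rU vU; rewrite erased_eventE// (follows_prob (srwX.1 v)); last first.
  by move=> a b [Ea _] [Eb _]; exact: prefix_free_exits Eb.
have [p u b l] := climbP v rpi rU.
have := @wt_erased_tree _ _ st r st_ge0 srw_prefix_free_le1 srw_reach_root
  pi (~: U)%SET v (climb pi U v).
rewrite !finset.in_setC rU vU l => /(_ isT isT p u).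
have -> : all (mem (~: U)%SET) (belast v (climb pi U v)).
  by apply: sub_all b => z; rewrite /= finset.in_setC.
move=> /(_ isT isT); rewrite finset.setDE -finset.setCU => E.
apply: EFin_inj; rewrite -E EFinM fineK//.
rewrite -(follows_prob (srwX.1 v)).
  by apply: fin_num_measure; exact: follows_measurable (srwX.1 v) _ _.
by move=> c c' [Ec _] [Ec' _]; exact: prefix_free_exits Ec'.
Qed.

(** By independence the probability is a product of loop-erasure probabilities, and
    [erased_event_prob] makes the successive tree weights telescope. *)
Lemma wilson_paths_prob pi ord (U : {set V}) : rooted e r pi -> r \in U -> uniq ord ->
  (forall u, u \notin U -> u \in ord) ->
  P [set w | wilson_paths (fun v t => X v t w) ord U = Some (wpaths pi ord U)] =
  (tree_weight st pi (~: U)%SET)%:E.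
Proof.
move=> rpi rU uo Uo.
(* Vertices from which no walk is started get the full event, so the product may range over all
   vertices. *)
pose F ord U u : set Omega := if start_tree pi ord U u is Some U'
  then erased_event u U' (u :: climb pi U' u) else setT.
have -> : [set w | wilson_paths (fun v t => X v t w) ord U = Some (wpaths pi ord U)] =
    [set w | forall u, F ord U u w].
  apply/seteqP; split=> w /=.
    move=> /(wilson_paths_start _ _ _ uo) H u; rewrite /F.
    by case E: start_tree => [U'|]//; exact: H.
  move=> H; apply/(wilson_paths_start _ _ _ uo) => u U' E.
  by have := H u; rewrite /F E.
have psF u : process_sigma (X u) (F ord U u).
  rewrite /F; case: start_tree => [U'|]; first exact: process_sigma_erased.
  exact: (@measurableT _ (g_sigma_algebraType _)).
rewrite srwX.2//; congr EFin; elim: ord U rU uo Uo {psF} => [|v ord IH] U rU uo Uo.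
  rewrite big1; last by move=> u _; rewrite /F/= probability_setT.
  have -> : (~: U = finset.set0)%SET.
    by apply/finset.setP => u; rewrite finset.in_setC finset.in_set0; apply/negbF/negPn/negP => /Uo.
  by rewrite /tree_weight big_set0 green_prod0 mulr1.
move: uo => /= /andP[vo uo].
have [vU|vU] := boolP (v \in U).
  rewrite -IH//; last by move=> u uU; have := Uo u uU; rewrite inE; case: eqP uU => // ->; rewrite vU.
  by apply: eq_bigr => u _; rewrite /F/= vU.
rewrite -(erased_event_prob rpi rU vU) -IH//; last 2 first.
- by rewrite finset.in_setU rU.
- move=> u; rewrite finset.in_setU negb_or !inE => /andP[uU /norP[uv _]].
  by have := Uo u uU; rewrite inE (negPf uv).
rewrite [LHS](bigD1 v)//= [in RHS](bigD1 v)//=; congr (_ * _).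
  by rewrite /F/= (negPf vU) eqxx.
rewrite {2}/F start_tree_notin// probability_setT/= mul1r.
by apply: eq_bigr => u uv; rewrite /F/= (negPf vU) (negPf uv).
Qed.
End WilsonLaw.

(** * Almost sure behaviour of the walks *)

Section WalkAlmostSurely.
Context {R : realType} {d : measure_display} {Omega : measurableType d}.
Variables (P : probability Omega R) (V : finType) (e : rel V) (r : V).
Variable (X : V -> nat -> Omega -> V).
Hypothesis srwX : independent_srws P e X.
Hypothesis er : forall x, connect e x r.
Let st := srw_step (R := R) e.
Let st_ge0 : forall x y, 0 <= st x y := srw_step_ge0 (R := R) e.
Let wt_le1 : forall x S, prefix_free S -> (wt st x S <= 1)%E :=
  srw_prefix_free_le1 srwX.

Lemma srw_measurable v t x : measurable (X v t @^-1` [set x]).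
Proof. by case: (srwX.1 v). Qed.

Lemma srw_start_ae v : {ae P, forall w, X v 0 w = v}.
Proof.
apply/negligibleP; last first.
  rewrite -[RHS](srw_start srwX v); congr (P _).
  by apply/seteqP; split=> w /= /eqP.
by apply: measurableC; exact: srw_measurable.
Qed.

(** A trajectory that leaves the edges follows some word that is not a path; there are countably
    many such words, each of weight 0. *)
Lemma srw_adj_ae v : {ae P, forall w, forall t, e (X v t w) (X v t.+1 w)}.
Proof.
have N : P.-negligible (follows (X v) v [set q | ~~ path e v q]).
  pose F k := if unpickle k is Some q then
    (if path e v q then set0 else follow (X v) v q) else set0.
  apply: (@negligibleS _ _ _ P (\bigcup_k F k)).
    move=> w [q npq fq]; exists (pickle q) => //=; rewrite /F pickleK.
    by rewrite (negPf npq).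
  apply: negligible_bigcup => k; rewrite /F; case: unpickle => [q|]; last exact: negligible_set0.
  case: ifPn => pq; first exact: negligible_set0.
  apply/negligibleP; first exact: (follow_measurable (srwX.1 v)).
  by apply: etrans (follow_prob (srwX.1 v) q) _; rewrite wgt_not_path.
have := srw_start_ae v; rewrite /almost_everywhere/=.
move=> N0; apply: negligibleS (negligibleU N N0) => w /= /existsNP[t /negP te].
have [X0|X0] := pselect (X v 0 w = v); last by right.
left; pose q := mkseq (fun i => X v i.+1 w) t.+1.
have sq : size q = t.+1 by rewrite size_mkseq.
have fq : follow (X v) v q w.
  by move=> [|i]; rewrite ?X0// sq => it; rewrite [RHS]nth_mkseq.
exists q => //; apply: contra te => /(pathP v)/(_ t); rewrite sq => /(_ (ltnSn _)).
by rewrite -(fq t) ?sq// -[nth v q t]/(nth v (v :: q) t.+1) -fq ?sq.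
Qed.

(** Sorted by their last vertex, the confined walks split into finitely many classes, each weighing
    a finite Green function. *)
Lemma wt_confined_fin (A : {set V}) v : r \notin A -> v \in A ->
  (wt st v [set q | all (mem A) q] < +oo)%E.
Proof.
move=> rA vA.
have H (s : seq V) : {subset s <= A} ->
    (wt st v [set q | all (mem A) q /\ last v q \in s] < +oo)%E.
  elim: s => [_|y s IH sA].
    rewrite (_ : [set _ | _] = set0) ?/wt ?esum_set0 ?ltry//.
    by rewrite -subset0 => q [].
  rewrite (_ : [set _ | _] = walks A v y `|` ([set q | all (mem A) q /\ last v q \in s] `\` walks A v y)).
    rewrite wtU//; last by move=> q ? [].
    apply: lte_add_pinfty.
      by rewrite -ge0_fin_numE ?wt_ge0//; apply: (green_fin (r := r)) => //;
        [exact: srw_reach_root|apply: sA; rewrite mem_head].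
    apply: le_lt_trans (IH _); last by move=> z zs; apply: sA; rewrite inE zs orbT.
    by apply: wtS => // q [].
  apply/seteqP; split=> q /=; rewrite inE.
    move=> [qA lq]; have [ly|ly] := eqVneq (last v q) y; first by left.
    right; split; last by move=> [_ /eqP]; rewrite (negPf ly).
    by move: lq; rewrite (negPf ly).
  by move=> [[qA /eqP ->]|[[qA ->] _]]; split=> //; rewrite orbT.
apply: le_lt_trans (H (enum A) _); last by move=> z; rewrite mem_enum.
apply: wtS => // q qA; split=> //; rewrite mem_enum.
by have := mem_last v q; rewrite inE => /predU1P[->//|/(allP qA)].
Qed.

(* The confined walks have finite total weight, whereas never hitting [U] has
   probability at most the weight of the confined walks of each length. *)
Lemma srw_hit_ae v (U : {set V}) : r \in U -> {ae P, forall w, exists t, X v t w \in U}.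
Proof.
move=> rU; have [vU|vU] := boolP (v \in U).
  by apply: filterS (srw_start_ae v) => w X0; exists 0%N; rewrite X0.
pose N := [set w | forall t, X v t w \notin U].
have mN : measurable N.
  rewrite (_ : N = \bigcap_t (~` \bigcup_(x in [set` U]) (X v t @^-1` [set x]))).
    apply: bigcap_measurableType => t _; apply: measurableC.
    by apply: fin_bigcup_measurable => // x _; exact: srw_measurable.
  apply/seteqP; split=> w H t; first by move=> _ [x /= xU Xx]; have := H t; rewrite Xx xU.
  by apply/negP => tU; apply: (H t I); exists (X v t w).
suff N0 : P N = 0.
  apply: (@negligibleS _ _ _ P N); last exact/negligibleP.
  by move=> w /= /forallNP H t; exact/negP/H.
pose A := (~: U)%SET; pose W t := [set q | size q = t /\ all (mem A) q].
have NW t : (P N <= wt st v (W t))%E.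
  have pfW : prefix_free (W t).
    move=> a b [sa _] [sab _]; apply/nilP; move: sab; rewrite size_cat sa /nilp => /eqP.
    by rewrite -[X in _ == X]addn0 eqn_add2l.
  rewrite -(follows_prob (srwX.1 v) pfW).
  have mF := follows_measurable (srwX.1 v) v (W t).
  have m0 := measurableC (srw_measurable v 0 v).
  have : (P N <= P (follows (X v) v (W t) `|` ~` (X v 0%N @^-1` [set v])))%E.
    apply: le_measure; rewrite ?inE//; first exact: measurableU.
    move=> w Nw; have [X0|X0] := pselect (X v 0 w = v); last by right.
    left; exists (mkseq (fun i => X v i.+1 w) t); last first.
      by move=> [|i]; rewrite ?X0// size_mkseq => it; rewrite [RHS]nth_mkseq.
    split; first by rewrite size_mkseq.
    by apply/allP => _ /mapP[i _ ->]; rewrite /= finset.in_setC; exact: Nw.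
  move=> /le_trans; apply; apply: (le_trans (measureU2 P mF m0)).
  have P0 : P (~` (X v 0%N @^-1` [set v])) = 0.
    by rewrite -[RHS](srw_start srwX v); congr (P _); apply/seteqP; split=> w /= /eqP.
  by rewrite [X in (_ + X)%E]P0 adde0.
have NT T : (T%:R%:E * P N <= wt st v [set q | (size q < T)%N /\ all (mem A) q])%E.
  elim: T => [|T IH]; first by rewrite mul0e wt_ge0.
  rewrite (_ : [set _ | _] = [set q | (size q < T)%N /\ all (mem A) q] `|` W T).
    rewrite wtU//; last by move=> q [qT _] [qT' _]; move: qT; rewrite qT' ltnn.
    by rewrite -natr1 EFinD ge0_muleDl ?lee_fin// mul1e leeD.
  apply/seteqP; split=> q /=; last by case=> -[]; [move=> /ltnW|move=> ->].
  by rewrite ltnS leq_eqVlt => -[/predU1P[|]]; [right|left].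
have /fineK PN : P N \is a fin_num by exact: fin_num_measure.
have /fineK B : wt st v [set q | all (mem A) q] \is a fin_num.
  by rewrite ge0_fin_numE ?wt_ge0// wt_confined_fin// finset.in_setC ?rU.
set b := fine _ in B; set c := fine _ in PN.
have {}NT T : T%:R * c <= b.
  rewrite -lee_fin EFinM PN B; apply: le_trans (NT T) _.
  by apply: wtS => // q [].
have c0 : 0 <= c by rewrite -lee_fin PN.
rewrite -PN; congr EFin; apply/eqP; rewrite eq_le c0 andbT leNgt; apply/negP => cp.
have := NT (Num.truncn (b / c)).+1; rewrite -ler_pdivlMr//.
by rewrite leNgt truncnS_gt.
Qed.
End WalkAlmostSurely.

(** * Every run with good trajectories comes from a parent function *)

Section Outcomes.
Variables (V : finType) (e : rel V) (r : V) (x : V -> nat -> V).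
Hypothesis x0 : forall v, x v 0%N = v.
Hypothesis xe : forall v t, e (x v t) (x v t.+1).
Hypothesis hit : forall v (U : {set V}), r \in U -> exists t, x v t \in U.
Implicit Types (U : {set V}) (pi : {ffun V -> V}).

Lemma erased_walkP v U : r \in U -> v \notin U ->
  exists g, [/\ omap (@loop_erasure V) (walk_until (x v) U) = Some (v :: g),
    path e v g, uniq (v :: g), all (predC (mem U)) (belast v g) & last v g \in U].
Proof.
move=> rU vU; case E : (walk_until _ _) => [w|]; last first.
  by have [t] := hit v rU; rewrite (negPf (walk_until_none E t)).
have [k [wE kU iU]] := walk_until_some E.
have [q wq] : exists q, w = v :: q by rewrite wE /mkseq /= x0; eexists.
have [g LE] := loop_erasure_cons v q; rewrite -wq in LE.
have uLE := uniq_loop_erasure w; rewrite LE in uLE.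
have pq : path e v q.
  apply/(pathP v) => i iq; rewrite -wq.
  have sw : size w = k.+1 by rewrite wE size_mkseq.
  have {}iq : (i.+1 < k.+1)%N by rewrite -sw wq.
  rewrite -[nth v q i]/(nth v (v :: q) i.+1) -wq wE !nth_mkseq//; last exact: ltnW.
have lg : last v g = x v k.
  have := last_loop_erasure v w; rewrite LE /= => ->; rewrite wE /mkseq -nth_last size_map size_iota.
  by rewrite -/(mkseq _ _) nth_mkseq.
exists g; split=> //=; first by rewrite LE.
- by have := path_loop_erasure pq; rewrite -wq LE.
- apply/allP => u ub; apply/negP => /= uU.
  have : u \in w by apply: mem_loop_erasure; rewrite LE mem_belast.
  rewrite wE => /mapP[i]; rewrite mem_iota add0n ltnS => /andP[_ ik] uE.
  move: uLE; rewrite lastI rcons_uniq lg => /andP[/negP kb _]; apply: kb.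
  have [<-|ik'] := eqVneq i k; first by rewrite -uE.
  by have := iU i; rewrite ltn_neqAle ik' ik -uE uU => /(_ isT).
- by rewrite lg.
Qed.

(** The invariant of the run: on the current tree [U] the parents already lead to [r] inside [U],
    while values off [U] are arbitrary. *)
Definition rooted_on pi U := [/\ r \in U, pi r = r &
  forall u, u \in U -> [/\ pi u \in U, u != r -> e u (pi u) & fconnect pi u r]].

Lemma connect_last (f : rel V) y q u : path f y q -> u \in y :: q ->
  connect f u (last y q).
Proof.
elim: q y u => [|z q IH] y u /=; first by rewrite inE => _ /eqP ->.
move=> /andP[yz zq]; rewrite inE => /predU1P[->|]; last exact: IH.
by apply: connect_trans (connect1 yz) (IH z z zq (mem_head _ _)).
Qed.

Lemma rooted_on_extend pi v U g : rooted_on pi U ->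
  path e v g -> uniq (v :: g) -> all (predC (mem U)) (belast v g) -> last v g \in U ->
  exists pi', [/\ rooted_on pi' (U :|: [set z in v :: g]), {in U, pi' =1 pi}
    & path (frel pi') v g].
Proof.
move=> [rU rr piU] eg ug gU lU.
(* Each vertex of the new path before its last gets its successor on the path as parent. *)
pose pi' : {ffun V -> V} :=
  [ffun u => if u \in belast v g then nth r g (index u (v :: g)) else pi u].
have pi'U : {in U, pi' =1 pi}.
  by move=> u uU; rewrite ffunE; case: ifP => // /(allP gU); rewrite /= uU.
have pi'g i : (i < size g)%N -> pi' (nth r (v :: g) i) = nth r g i.
  move=> ig; rewrite ffunE index_uniq//= 1?ltnW//.
  have -> : nth r (v :: g) i = nth r (belast v g) i by rewrite lastI nth_rcons size_belast ig.
  by rewrite mem_nth ?size_belast.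
have pg : path (frel pi') v g.
  by apply/(pathP r) => i ig; rewrite /= pi'g.
have cU u : u \in U -> fconnect pi' u r.
  move=> uU; have [_ _ /iter_findex E] := piU _ uU.
  have H k : (iter k pi' u = iter k pi u) /\ iter k pi u \in U.
    elim: k => //= k [-> kU]; rewrite pi'U//; split=> //.
    by case: (piU _ kU).
  by rewrite -E -(H _).1; exact: fconnect_iter.
exists pi'; split=> //; split=> [||u].
- by rewrite finset.in_setU rU.
- by rewrite pi'U.
rewrite finset.in_setU inE => /orP[uU|ug'].
  have [? ? ?] := piU u uU; split; last exact: cU.
    by rewrite pi'U// finset.in_setU; apply/orP; left.
  by rewrite pi'U.
have cu : fconnect pi' u r by apply: connect_trans (connect_last pg ug') (cU _ lU).
have [uU|uU] := boolP (u \in U).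
  have [? ? ?] := piU u uU; split=> //; last by rewrite pi'U.
  by rewrite pi'U// finset.in_setU; apply/orP; left.
have ub : u \in belast v g.
  move: ug'; rewrite lastI mem_rcons inE => /predU1P[ul|//].
  by rewrite ul lU in uU.
have [i ig uE] : exists2 i, (i < size g)%N & u = nth r (v :: g) i.
  exists (index u (belast v g)); first by rewrite -[X in (_ < X)%N](size_belast v) index_mem.
  rewrite lastI nth_rcons index_mem ub nth_index//.
split=> // [|_].
  by rewrite uE pi'g// finset.in_setU inE inE mem_nth// !orbT.
by rewrite uE pi'g//; exact: (pathP r eg).
Qed.

(** The parent function is built along the run. Later extensions do not change it on the tree
    already built, so each path added remains the climb of the final parent function. *)
Lemma wilson_outcome ord U pi : rooted_on pi U -> (forall u, u \notin U -> u \in ord) ->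
  exists pi', [/\ rooted e r pi', {in U, pi' =1 pi}
    & wilson_paths x ord U = Some (wpaths pi' ord U)].
Proof.
elim: ord U pi => [|v ord IH] U pi rpi Uo.
  have [rU rr piU] := rpi.
  have allU u : u \in U by apply/negPn/negP => /Uo.
  exists pi; split=> //; rewrite /rooted rr eqxx/=; apply/andP; split.
    by apply/forallP => u; apply/implyP; case: (piU u).
  by apply/forallP => u; case: (piU u).
rewrite /=; case: ifPn => vU.
  apply: IH => // u uU; have := Uo u uU; rewrite inE => /predU1P[uv|//].
  by rewrite uv vU in uU.
have [rU rr piU] := rpi.
have [g [E eg ug gU lU]] := erased_walkP rU vU.
have [pi1 [rpi1 pi1U pg]] := rooted_on_extend rpi eg ug gU lU.
case E2 : (walk_until _ _) E => [w|//] [E]; rewrite E.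
have [|pi2 [rpi2 pi2U ->]] := IH _ pi1 rpi1.
  move=> u; rewrite finset.in_setU inE negb_or inE => /andP[uU /norP[uv _]].
  by have := Uo u uU; rewrite inE (negPf uv).
exists pi2; split=> //.
  by move=> u uU; rewrite pi2U ?pi1U// finset.in_setU uU.
have -> // : climb pi2 U v = g.
apply: climb_path => //; apply/(pathP r) => i ig.
have /(_ i ig) := pathP r pg; rewrite /= => /eqP <-; apply/eqP.
apply: pi2U; rewrite finset.in_setU inE mem_nth ?orbT//=.
exact: ltnW.
Qed.
End Outcomes.

(** * Spanning trees of parent functions *)

Section ParentTree.
Variables (V : finType) (e : rel V) (r : V).
Variable pi : {ffun V -> V}.
Hypothesis rpi : rooted e r pi.
Implicit Types (U : {set V}) (u v : V).

(** The whole tree is the case where [U] contains only the root; a general [U] serves the induction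
    along the run, which adds the remaining edges. *)
Definition tree_edges U : {set {set V}} := [set [set u; pi u] | u in ~: U]%SET.

Lemma set2_inj (a b c d : V) : [set a; b]%SET = [set c; d]%SET ->
  (a = c /\ b = d) \/ (a = d /\ b = c).
Proof.
move=> /finset.setP E; have := E a; have := E b; have := E c; have := E d.
rewrite !finset.in_set2 !eqxx !orbT => /orP Ed /orP Ec /esym/orP Eb /esym/orP Ea.
by case: Ea; case: Eb; case: Ec; case: Ed; move=> /eqP + /eqP + /eqP + /eqP;
  move=> *; subst; auto.
Qed.

Lemma tadj_treeE U u v :
  tadj (tree_edges U) u v =
  (u \notin U) && (pi u == v) || (v \notin U) && (pi v == u).
Proof.
apply/imsetP/orP => [[x]|].
  rewrite finset.in_setC => xU /set2_inj[[-> ->]|[-> ->]]; rewrite xU eqxx; auto.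
case=> /andP[xU /eqP <-]; [exists u|exists v]; rewrite ?finset.in_setC//.
by apply/finset.setP => z; rewrite !finset.in_set2 orbC.
Qed.

Lemma path_edges_climb v g : path (frel pi) v g ->
  path_edges (v :: g) = [set [set u; pi u] | u in belast v g]%SET.
Proof.
elim: g v => [|w g IH] v /=.
  by move=> _; apply/finset.setP => z; rewrite inE; apply/esym/imsetP => -[].
move=> /andP[/eqP <- pg]; apply/finset.setP => z; rewrite inE/= inE.
have := congr1 (fun A : {set {set V}} => z \in A) (IH _ pg); rewrite /path_edges inE/= => ->.
apply/orP/imsetP => [[/eqP ->|/imsetP[u uv ->]]|[u]].
- by exists v; rewrite ?mem_head.
- by exists u; rewrite // inE uv orbT.
- by rewrite inE => /predU1P[->|uv] ->; [left|right; apply/imsetP; exists u].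
Qed.

Lemma tree_edges_wpaths ord U : r \in U -> (forall u, u \notin U -> u \in ord) ->
  (\bigcup_(p <- wpaths pi ord U) path_edges p)%SET = tree_edges U.
Proof.
elim: ord U => [|v ord IH] U rU Uo /=.
  rewrite big_nil; apply/esym/finset.setP => z; rewrite finset.in_set0.
  by apply/imsetP => -[u]; rewrite finset.in_setC => /Uo.
case: ifPn => vU.
  apply: IH => // u uU; have := Uo u uU; rewrite inE => /predU1P[uv|//].
  by rewrite uv vU in uU.
have [p _ b l] := climbP v rpi rU.
rewrite big_cons IH; first last.
- move=> u; rewrite finset.in_setU inE negb_or inE => /andP[uU /norP[uv _]].
  by have := Uo u uU; rewrite inE (negPf uv).
- by rewrite finset.in_setU rU.
rewrite path_edges_climb//; apply/finset.setP => z; rewrite finset.in_setU.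
apply/orP/imsetP => [[/imsetP|/imsetP]|] [u].
- by move=> /(allP b)/= uU ->; exists u; rewrite ?finset.in_setC.
- rewrite !finset.in_setC finset.in_setU negb_or => /andP[uU _] ->.
  by exists u; rewrite ?finset.in_setC.
- rewrite finset.in_setC => uU ->; have [ub|ub] := boolP (u \in belast v (climb pi U v)).
    by left; apply/imsetP; exists u.
  right; apply/imsetP; exists u => //; rewrite finset.in_setC finset.in_setU (negPf uU)/= inE.
  by rewrite lastI mem_rcons inE negb_or ub andbT; apply: contraNneq uU => ->.
Qed.

Definition trunk s : seq V := s :: climb pi [set r]%SET s.

Lemma wilson_tree (x : V -> nat -> V) s ord : s != r ->
  (forall u, u != r -> u \in s :: ord) ->
  wilson_paths x (s :: ord) [set r]%SET = Some (wpaths pi (s :: ord) [set r]%SET) ->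
  wilson x r (s :: ord) = Some (trunk s, tree_edges [set r]%SET).
Proof.
move=> sr ro E; rewrite /wilson E /omap /obind /oapp; congr (Some (_, _)).
  by rewrite [wpaths _ _ _]/= finset.in_set1 (negPf sr).
apply: tree_edges_wpaths; first exact: finset.set11.
by move=> u; rewrite finset.in_set1 => /ro.
Qed.

Let T := tree_edges [set r]%SET.

Lemma rooted_adj u : u != r -> e u (pi u).
Proof. by case/and3P: rpi => _ /forallP/(_ u)/implyP H _. Qed.

Lemma tadj_sym (W : {set {set V}}) : symmetric (tadj W).
Proof. by move=> u v; rewrite /tadj/= finset.setUC. Qed.

Lemma tadj_parent u : u != r -> tadj T u (pi u).
Proof. by move=> ur; rewrite tadj_treeE finset.in_set1 ur eqxx. Qed.

Lemma rooted_root : pi r = r.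
Proof. by case/and3P: rpi => /eqP. Qed.

Lemma connect_root u : connect (tadj T) u r.
Proof.
have [k kr] := rooted_reach u rpi; elim: k u kr => [|k IH] u; first by move=> /= ->.
rewrite iterSr => /IH; have [->|ur] := eqVneq u r; first by rewrite rooted_root.
by apply: connect_trans; apply: connect1; exact: tadj_parent.
Qed.

Definition depth u := size (climb pi [set r]%SET u).

Lemma depth_parent u : u != r -> depth u = (depth (pi u)).+1.
Proof. by move=> ur; rewrite /depth (climbS rpi)// finset.in_set1. Qed.

(** Children are strictly deeper than their parent, so at a deepest vertex of a cycle both
    neighbours are its parent. Then the cycle has no third vertex. *)
Lemma tree_acyclic : acyclic (tadj T).
Proof.
move=> c c2 uc; apply/negP => cc.
have [v0 v0c] : exists v0, v0 \in c by case: c c2 {uc cc} => // v0 c _; exists v0; rewrite mem_head.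
have [v vc vmax] := @arg_maxnP _ v0 (mem c) depth v0c.
have up u : u \in c -> tadj T v u -> u = pi v.
  move=> ucc; rewrite tadj_treeE => /orP[/andP[_ /eqP ->]//|].
  rewrite finset.in_set1 => /andP[ur /eqP E]; have := vmax u ucc.
  by rewrite (depth_parent ur) E /= ltnn.
have E1 : next c v = pi v.
  by apply: up; rewrite ?mem_next//; exact: next_cycle.
have E2 : prev c v = pi v.
  by apply: up; rewrite ?mem_prev// tadj_sym; exact: prev_cycle.
have [i c' E] := rot_to vc.
have E3 : next c (next c v) = v by rewrite E1 -E2 next_prev.
have : uniq (v :: c') by rewrite -E rot_uniq.
have : (2 < size (v :: c'))%N by rewrite -E size_rot.
move: E3; rewrite -!(next_rot i uc) E.
case: c' {E} => [//|a [//|b c']] /= + _; rewrite eqxx !inE !negb_or.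
by case: eqVneq => //= _; rewrite eqxx => ->; rewrite eqxx /= ?andbF.
Qed.

Lemma tree_spanning : spanning_tree e T.
Proof.
split; last exact: tree_acyclic.
- apply/fintype.subsetP => z /imsetP[u]; rewrite finset.in_setC finset.in_set1 => ur ->.
  by apply/imsetP; exists (u, pi u); rewrite //= inE/= rooted_adj.
- move=> u v; apply: connect_trans (connect_root u) _.
  by rewrite (sym_connect_sym (tadj_sym T)) connect_root.
Qed.

Lemma trunk_simple s : simple_path_in T (trunk s).
Proof.
have [p u b _] := climbP s rpi (finset.set11 r); split; first exact: u.
rewrite /trunk; move: (climb pi [set r]%SET s) p b {u} => g; elim: g s => //= v g IH s.
move=> /andP[/eqP <- pg] /andP[sr bg]; rewrite IH// andbT tadj_parent//.
by rewrite finset.in_set1 in sr.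
Qed.
End ParentTree.

(** * Branches as climbs to the trunk *)

Section Branches.
Variables (V : finType) (e : rel V) (r : V).
Variable pi : {ffun V -> V}.
Hypothesis rpi : rooted e r pi.
Implicit Types (u v s : V).

Let T := tree_edges pi [set r]%SET.

Definition trunk_set s : {set V} := [set z in trunk r pi s]%SET.

Lemma root_trunk s : r \in trunk_set s.
Proof.
have [_ _ _ l] := climbP s rpi (finset.set11 r).
by move: l; rewrite finset.in_set1 => /eqP rE; rewrite inE -{1}rE mem_last.
Qed.

Lemma trunk_parent s u : u \in trunk_set s -> pi u \in trunk_set s.
Proof.
have [p _ _ l] := climbP s rpi (finset.set11 r).
rewrite !inE => us; have [->|ur] := eqVneq u r.
  by rewrite (rooted_root rpi); have := root_trunk s; rewrite inE.
move: us; rewrite /trunk; move: l p; rewrite finset.in_set1.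
move: (climb pi [set r]%SET s) => g; elim: g s => [|v g IH] s /=.
  by move=> /eqP -> _; rewrite inE (negPf ur).
move=> l /andP[/eqP sv pg]; rewrite inE => /predU1P[->|ug].
  by rewrite sv !inE eqxx orbT.
by rewrite inE IH ?orbT.
Qed.

(** One endpoint is the parent of the other, so both climbs enter the trunk at the same vertex; this
    vertex is thus constant on a component off the trunk. *)
Lemma tree_entry s u v : u \notin trunk_set s -> v \notin trunk_set s -> tadj T u v ->
  last u (climb pi (trunk_set s) u) = last v (climb pi (trunk_set s) v).
Proof.
have main a b : a \notin trunk_set s -> pi a = b ->
    last a (climb pi (trunk_set s) a) = last b (climb pi (trunk_set s) b).
  by move=> aL ab; rewrite (climbS rpi (root_trunk s) aL) ab.
move=> uL vL; rewrite tadj_treeE => /orP[/andP[_ /eqP]|/andP[_ /eqP]]; first exact: main.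
by move=> vu; symmetry; exact: main.
Qed.

Lemma gdist_le (f : rel V) u q : path f u q -> (size q < #|V|)%N ->
  (gdist f u (last u q) <= size q)%N.
Proof.
move=> pq sq; rewrite leqNgt; apply/negP => /(before_find 0%N).
by rewrite nth_iota// add0n => /existsP; apply; exists (in_tuple q); rewrite pq eqxx.
Qed.

(** The common entry vertex of the component is [a], since a vertex off the trunk adjacent to [a]
    can only have it as parent: parents of trunk vertices lie on the trunk. The climb of a farthest
    vertex is then a path to [a]. *)
Lemma branch_climb s l : has_branch_ge T (trunk r pi s) l ->
  exists2 v, v \notin trunk_set s & (l <= size (climb pi (trunk_set s) v))%N.
Proof.
move=> [B [a [[[v0 v0L BE] aL [v1 v1B v1a]] lB]]].
have inL z : (z \in trunk_set s) = (z \in trunk r pi s) by rewrite inE.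
have compB v : v \in B -> v \notin trunk_set s /\
    last v (climb pi (trunk_set s) v) = last v0 (climb pi (trunk_set s) v0).
  rewrite BE inE => /connectP[q pq ->]; elim/last_ind: q pq => [_|q z IH]; first by rewrite inL.
  rewrite rcons_path last_rcons => /andP[/IH[H1 H2]] /= /and3P[t _ zL].
  rewrite inL zL; split=> //; rewrite -H2; symmetry; apply: tree_entry => //.
  by rewrite inL.
have entry_a v : v \in B -> last v (climb pi (trunk_set s) v) = a.
  move=> vB; rewrite (compB v vB).2 -(compB v1 v1B).2.
  have v1L := (compB v1 v1B).1.
  have pv1 : pi v1 = a.
    move: v1a; rewrite tadj_treeE => /orP[/andP[_ /eqP]//|/andP[_ /eqP av]].
    by rewrite -av trunk_parent ?inL in v1L.
  by rewrite (climbS rpi (root_trunk s) v1L) pv1 climb0 ?inL.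
have [v vB vE] : {v | v \in B & branch_length T B a = gdist (tadj T) v a}.
  by apply: eq_bigmax_cond; apply/card_gt0P; exists v0; rewrite BE inE.
exists v; first exact: (compB v vB).1.
apply: leq_trans lB _; rewrite vE -(entry_a v vB).
have [p u b _] := climbP v rpi (root_trunk s).
(* The climb repeats no vertex, so its length is below [#|V|] and the search in [gdist] reaches
   it. *)
apply: gdist_le; last by rewrite -[X in (X <= _)%N](card_uniqP u) max_card.
have bL z : z \in belast v (climb pi (trunk_set s) v) -> z != r.
  by move=> /(allP b) /=; apply: contraNneq => ->; exact: root_trunk.
move: (climb pi (trunk_set s) v) p bL => g {vB vE u b}; elim: g v => //= w g IH v /andP[/eqP <- pg] bL.
rewrite tadj_parent ?bL ?mem_head//=; apply: IH => // z zg; apply: bL.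
by rewrite inE zg orbT.
Qed.
End Branches.

(** * Ring surgery *)

Section SurgeryCounting.
Local Open Scope nat_scope.
Variables (T J : finType) (A : {set T}) (F : J -> T -> T) (good : J -> pred T) (K : nat).
Hypothesis FA : forall j t, t \in A -> F j t \in A.
Hypothesis F_good : forall j t, t \in A -> good j (F j t).
Hypothesis F_other : forall i j t, t \in A -> i != j -> good i (F j t) = good i t.
Hypothesis F_fiber : forall j t', #|[set t in A | F j t == t']%SET| <= K.

Definition all_bad (W : seq J) : {set T} :=
  [set t in A | all (fun j => ~~ good j t) W]%SET.

Lemma card_fibers (S S' : {set T}) (f : T -> T) : (forall t, t \in S -> f t \in S') ->
  (forall t', #|[set t in S | f t == t']%SET| <= K) -> #|S| <= K * #|S'|.
Proof.
move=> fS fK; rewrite -sum1_card (partition_big f (mem S'))//=.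
rewrite -sum1_card big_distrr/=; apply: leq_sum => t' _.
rewrite muln1 -[X in (X <= _)%N]/(\sum_(i in S | f i == t') 1)%N.
apply: leq_trans (fK t'); rewrite -sum1_card.
by apply: eq_leq; apply: eq_bigl => t; rewrite inE.
Qed.

(** The surgery [F j] sends what is bad on [j :: W] into what is bad on [W] but good at [j], at most
    [K] to one. Adding [K] times the part bad at [j] turns the factor [K] on the left into
    [K.+1]. *)
Lemma card_all_bad_cons j W : j \notin W ->
  K.+1 * #|all_bad (j :: W)| <= K * #|all_bad W|.
Proof.
move=> jW; have sub : all_bad (j :: W) \subset all_bad W.
  by apply/fintype.subsetP => t; rewrite !inE /= => /and3P[-> _ ->].
rewrite -(cardsID (all_bad (j :: W)) (all_bad W)) (finset.setIidPr sub) mulnDr mulSn addnC leq_add2l.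
apply: (@card_fibers _ _ (F j)) => [t|t'].
  rewrite !inE /= => /and3P[tA _ tW]; rewrite FA// F_good//=.
  apply/allP => i iW; rewrite F_other//; first exact: (allP tW).
  by apply: contraNneq jW => <-.
apply: leq_trans (F_fiber j t'); apply: subset_leq_card.
by apply/fintype.subsetP => t; rewrite !inE => /andP[/andP[-> _] ->].
Qed.

Lemma card_all_bad W : uniq W -> K.+1 ^ size W * #|all_bad W| <= K ^ size W * #|A|.
Proof.
elim: W => [_|j W IH].
  rewrite !mul1n subset_leq_card//; apply/fintype.subsetP => t.
  by rewrite inE => /andP[].
move=> /= /andP[jW uW]; rewrite !expnSr -mulnA.
apply: leq_trans (leq_mul (leqnn _) (card_all_bad_cons jW)) _.
by rewrite mulnCA [K ^ _ * K]mulnC -mulnA leq_mul2l IH// orbT.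
Qed.
End SurgeryCounting.

Section CylinderGraph.
Variables n m : nat.
Hypothesis n2 : (1 < n)%N.
Local Notation V := (cyl n m).
Local Notation e := (@cyl_adj n m).
Implicit Types (u v : V).

Lemma cyl_adj_sym : symmetric e.
Proof.
move=> u v; rewrite /cyl_adj [v.2 == _]eq_sym [v.1 == u.1]eq_sym.
by congr (_ && _ || _ && _); rewrite orbC.
Qed.

Lemma cyl_adj_ring u : e u (u.1 + 1, u.2).
Proof. by rewrite /cyl_adj /= !eqxx. Qed.

Lemma cyl_adj_up u v : e u v -> (v.2 <= u.2.+1)%N.
Proof.
by case/orP => /andP[/eqP E]; [rewrite E|case/orP => /eqP ->]; rewrite ?leqnSn// ltnW// ltnW.
Qed.

Lemma cyl_adj_down u v : e u v -> (u.2 <= v.2.+1)%N.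
Proof. by rewrite cyl_adj_sym; exact: cyl_adj_up. Qed.

Lemma cyl_connect u v : connect e u v.
Proof.
have ring w k : connect e w (w.1 + k%:R, w.2).
  elim: k => [|k IH]; first by rewrite addr0; case: w.
  apply: connect_trans IH _; apply: connect1.
  by rewrite -natr1 addrA; exact: (cyl_adj_ring (_, _)).
have ringT (i i' : 'Z_n) (j : 'I_m) : connect e (i, j) (i', j).
  have := ring (i, j) (i' - i : 'Z_n); rewrite natr_Zp /=.
  by rewrite addrCA subrr addr0.
have col (i : 'Z_n) k (j j' : 'I_m) : j' = (j + k)%N :> nat -> connect e (i, j) (i, j').
  elim: k j' => [|k IH] j' jE; first by rewrite (_ : j' = j)//; apply: val_inj; rewrite /= jE addn0.
  have jm : (j + k < m)%N by rewrite -ltnS -addnS -jE ltnW// ltnS.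
  apply: connect_trans (IH (Ordinal jm) erefl) _; apply: connect1.
  by rewrite /cyl_adj /= eqxx jE addnS eqxx !orbT.
have colT (i : 'Z_n) (j j' : 'I_m) : connect e (i, j) (i, j').
  have [jj|jj] := leqP j j'; first by apply: (col i (j' - j)%N); rewrite subnKC.
  rewrite (sym_connect_sym cyl_adj_sym); apply: (col i (j - j')%N); rewrite subnKC//; exact: ltnW.
by case: u v => i j [i' j']; exact: connect_trans (ringT i i' j) (colT i' j j').
Qed.

Lemma card_cyl_column : #|'Z_n| = n.
Proof. by rewrite card_ord Zp_cast. Qed.

(* Tells apart the at most four neighbours of [u]. *)
Definition cyl_code u v : bool * bool :=
  (u.2 == v.2, if u.2 == v.2 then v.1 == u.1 + 1 else v.2 == u.2.+1 :> nat).

Lemma cyl_code_inj u v v' : e u v -> e u v' -> cyl_code u v = cyl_code u v' -> v = v'.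
Proof.
case: v v' => [i j] [i' j']; rewrite /cyl_code /cyl_adj /= => uv uv' [Ej].
move: uv uv'; rewrite -Ej; case: (eqVneq u.2 j) Ej => [<- /esym jj'|_ _] /=.
  have {jj'} <- := eqP jj'.
  rewrite ![u.2 == _ :> nat](ltn_eqF (ltnSn _)) !andbF !orbF /= => ui ui' ii'.
  have [iu|iu] := eqVneq i (u.1 + 1); move: ii'; rewrite ?iu ?eqxx ?(negPf iu).
    by move=> /esym/eqP ->.
  move=> ii'; move: ui ui'; rewrite (negPf iu) -ii' /= => /eqP -> /eqP /addIr ->.
  by [].
move=> /andP[/eqP <- jj] /andP[/eqP <- jj'] jE; congr pair; apply/val_inj => /=.
have [ju|ju] := boolP (j == u.2.+1 :> nat).
  by move: jE; rewrite (eqP ju) eqxx => /esym/eqP ->.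
move: jj jj'; rewrite -jE (negPf ju) /= => /eqP -> /eqP [].
by [].
Qed.
End CylinderGraph.

Section RootedFacts.
Variables (V : finType) (e : rel V) (r : V).
Implicit Types (pi : {ffun V -> V}) (U : {set V}).

Lemma climb_adj pi U v : rooted e r pi -> r \in U -> path e v (climb pi U v).
Proof.
move=> rpi rU; have [p _ b _] := climbP v rpi rU.
have bL z : z \in belast v (climb pi U v) -> z != r.
  by move=> /(allP b) /=; apply: contraNneq => ->.
move: (climb pi U v) p bL => g {b}; elim: g v => //= w g IH v /andP[/eqP <- pg] bL.
rewrite (rooted_adj rpi) ?bL ?mem_head//=; apply: IH => // z zg; apply: bL.
by rewrite inE zg orbT.
Qed.

Lemma fconnect_closed (f g : V -> V) U u w : {in U, forall v, f v \in U} ->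
  {in U, f =1 g} -> u \in U -> fconnect f u w -> fconnect g u w.
Proof.
move=> fU fg uU /iter_findex <-.
suff H k : iter k g u = iter k f u /\ iter k f u \in U.
  by rewrite -(H _).1; exact: fconnect_iter.
by elim: k => //= k [-> kU]; rewrite -fg//; split=> //; exact: fU.
Qed.
End RootedFacts.

Section RingSurgery.
Variables n m : nat.
Hypothesis n2 : (1 < n)%N.
Local Notation V := (cyl n m).
Local Notation e := (@cyl_adj n m).
Variables r s : V.
Hypothesis ends : (r \in cyl_ring n m 0 /\ s \in cyl_ring n m m.-1) \/
      (r \in cyl_ring n m m.-1 /\ s \in cyl_ring n m 0).
Implicit Types (pi : {ffun V -> V}) (j : 'I_m) (u v : V).

Local Notation L pi := (trunk_set r pi s).

Definition clockwise j pi :=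
  [forall v : V, (v.2 == j) && (v \notin L pi) ==> (pi v == (v.1 + 1, v.2)%R)].

(** Trunk vertices keep their parents: this preserves the trunk, on which the redirected vertices of
    the ring depend to reach the root. *)
Definition make_clockwise j pi : {ffun V -> V} :=
  [ffun v => if (v.2 == j) && (v \notin L pi) then (v.1 + 1, v.2)%R else pi v].

(** A discrete intermediate value argument: an edge changes the ring index by at most 1. *)
Lemma path_cross_up x q (k : nat) : path e x q -> (x.2 <= k)%N -> (k <= (last x q).2)%N ->
  exists2 v, v \in x :: q & v.2 = k :> nat.
Proof.
elim: q x => [|y q IH] x /=.
  by move=> _ xk kx; exists x; rewrite ?mem_head//; apply/eqP; rewrite eqn_leq xk.
move=> /andP[xy pq]; rewrite leq_eqVlt => /predU1P[<- _|xk kl]; first by exists x; rewrite ?mem_head.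
have [||v vq vk] := IH y pq; [|exact: kl|by exists v; rewrite // inE vq orbT].
exact: leq_trans (cyl_adj_up xy) xk.
Qed.

Lemma path_cross_down x q (k : nat) : path e x q -> (k <= x.2)%N -> ((last x q).2 <= k)%N ->
  exists2 v, v \in x :: q & v.2 = k :> nat.
Proof.
elim: q x => [|y q IH] x /=.
  by move=> _ xk kx; exists x; rewrite ?mem_head//; apply/eqP; rewrite eqn_leq xk kx.
move=> /andP[xy pq]; rewrite leq_eqVlt => /predU1P[-> _|xk kl]; first by exists x; rewrite ?mem_head.
have [||v vq vk] := IH y pq; [|exact: kl|by exists v; rewrite // inE vq orbT].
by rewrite -ltnS (leq_trans xk)// cyl_adj_down.
Qed.

Lemma trunk_meets_ring pi (k : nat) : rooted e r pi -> (k < m)%N ->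
  exists2 v, v \in trunk r pi s & v.2 = k :> nat.
Proof.
move=> rpi km; have km1 : (k <= m.-1)%N by rewrite -ltnS prednK// (leq_ltn_trans _ km).
have p := climb_adj s rpi (finset.set11 r).
have [_ _ _] := climbP s rpi (finset.set11 r); rewrite finset.in_set1 => /eqP l.
move: ends; rewrite !inE => -[[/eqP r0 /eqP s0]|[/eqP r0 /eqP s0]].
  by apply: path_cross_down p _ _; rewrite ?s0 ?l ?r0.
by apply: path_cross_up p _ _; rewrite ?s0 ?l ?r0.
Qed.

Section OneRing.
Variables (pi : {ffun V -> V}) (j : 'I_m).
Hypothesis rpi : rooted e r pi.
Let pi' := make_clockwise j pi.

Lemma make_clockwise_trunk : {in L pi, pi' =1 pi}.
Proof. by move=> v vL; rewrite ffunE vL andbF. Qed.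

Lemma trunk_make_clockwise : trunk r pi' s = trunk r pi s.
Proof.
rewrite /trunk; congr cons; have [p _ b l] := climbP s rpi (finset.set11 r).
apply: climb_path => //; apply/(pathP r) => i ig.
have /(_ i ig) := pathP r p; rewrite /= => /eqP <-; apply/eqP.
apply: make_clockwise_trunk; rewrite inE /trunk mem_nth//=; exact: ltnW.
Qed.

Lemma trunk_set_make_clockwise : L pi' = L pi.
Proof. by rewrite /trunk_set trunk_make_clockwise. Qed.

Lemma fconnect_make_clockwise_trunk v : v \in L pi -> fconnect pi' v r.
Proof.
move=> vL; apply: (fconnect_closed (f := pi) (U := L pi)) => //.
- by move=> z; exact: (trunk_parent rpi).
- by move=> u uL; rewrite make_clockwise_trunk.
- by case/and3P: rpi => _ _ /forallP.
Qed.

(** The ring contains a trunk vertex, and clockwise steps run through the whole ring. At the first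
    trunk vertex met, the old parent path along the trunk takes over. *)
Lemma fconnect_make_clockwise_ring v : v.2 = j -> fconnect pi' v r.
Proof.
move=> vj; have [w wL wj] := trunk_meets_ring rpi (ltn_ord j).
have : exists k, ((v.1 + k%:R)%R, j) \in L pi.
  exists (w.1 - v.1 : 'Z_n)%R; rewrite natr_Zp addrCA subrr addr0 inE.
  by rewrite (_ : (w.1, j) = w)//; case: w wj {wL} => a b /= bj; congr pair; exact: val_inj.
move=> /ex_minnP[k kL kmin].
have H i : (i <= k)%N -> iter i pi' v = ((v.1 + i%:R)%R, j).
  elim: i => [|i IH] ik; first by rewrite addr0 -vj; case: (v).
  rewrite /= IH 1?ltnW// ffunE /= eqxx /=.
  have -> : ((v.1 + i%:R)%R, j) \notin L pi by apply/negP => /kmin; rewrite leqNgt ik.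
  by rewrite -natr1 addrA.
apply: connect_trans (fconnect_iter pi' k v) _.
by apply: fconnect_make_clockwise_trunk; rewrite H.
Qed.

Lemma rooted_make_clockwise : rooted e r pi'.
Proof.
apply/and3P; split.
- by rewrite make_clockwise_trunk ?(rooted_root rpi)//; exact: root_trunk rpi s.
- apply/forallP => v; apply/implyP => vr; rewrite ffunE.
  by case: ifP => _; [exact: cyl_adj_ring|exact: (rooted_adj rpi)].
apply/forallP => v; have [k kr] := rooted_reach v rpi.
(* Induction along the old parent path: off ring [j] the parent is unchanged, and on ring [j] the
   new path is already known to reach the root. *)
elim: k v kr => [|k IH] v; first by move=> /= ->.
rewrite iterSr => /IH piv; have [vj|vj] := eqVneq v.2 j; first exact: fconnect_make_clockwise_ring.
by apply: connect_trans piv; apply: connect1; rewrite /= ffunE (negPf vj).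
Qed.

Lemma clockwise_make_clockwise : clockwise j pi'.
Proof.
apply/forallP => v; apply/implyP; rewrite trunk_set_make_clockwise => H.
by rewrite ffunE H.
Qed.

Lemma clockwise_make_other i : i != j -> clockwise i pi' = clockwise i pi.
Proof.
move=> ij; apply: eq_forallb => v; rewrite trunk_set_make_clockwise.
case: eqP => //= vi; case: (v \in L pi) => //=.
by rewrite ffunE vi (negPf ij).
Qed.
End OneRing.

Definition parents : {set {ffun V -> V}} := [set pi : {ffun V -> V} | rooted e r pi]%SET.

(** The image determines the trunk and every parent except those of off-trunk vertices of ring [j].
    Each of these is one of at most four neighbours, which two bits record. *)
Lemma card_make_clockwise_fiber j pi' :
  (#|[set pi in parents | make_clockwise j pi == pi']%SET| <= 4 ^ n)%N.
Proof.
have cB : #|{ffun 'Z_n -> (bool * bool)%type}| = (4 ^ n)%N.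
  by rewrite card_ffun card_prod card_bool card_cyl_column.
rewrite -cB.
pose c pi : {ffun 'Z_n -> (bool * bool)%type} := [ffun i => cyl_code (i, j) (pi (i, j))].
rewrite -(@card_in_imset _ _ c); first exact: max_card.
move=> p q; rewrite !inE => /andP[rp /eqP pE] /andP[rq /eqP qE] /ffunP cE.
have LE : L p = L q.
  by rewrite -(trunk_set_make_clockwise j rp) -(trunk_set_make_clockwise j rq) pE qE.
apply/ffunP => v; have := congr1 (fun f : {ffun V -> V} => f v) (etrans pE (esym qE)).
rewrite !ffunE LE; case: ifP => // /andP[/eqP vj vL] _.
have vr : v != r by apply: contraNneq vL => ->; exact: root_trunk rq s.
apply: (@cyl_code_inj _ _ v); [exact: rooted_adj rp _ vr|exact: rooted_adj rq _ vr|].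
by have := cE v.1; rewrite !ffunE -vj; case: (v).
Qed.

Lemma card_not_clockwise (W : seq 'I_m) : uniq W ->
  ((4 ^ n).+1 ^ size W * #|all_bad parents clockwise W| <= (4 ^ n) ^ size W * #|parents|)%N.
Proof.
apply: (card_all_bad (F := make_clockwise)).
- by move=> j pi; rewrite !inE; exact: rooted_make_clockwise.
- by move=> j pi; rewrite inE; exact: clockwise_make_clockwise.
- by move=> i j pi; rewrite inE => rpi ij; exact: clockwise_make_other.
- exact: card_make_clockwise_fiber.
Qed.
End RingSurgery.

(** * Climbs confined between clockwise rings *)

Section LongBranches.
Local Open Scope nat_scope.
Variables n m : nat.
Hypothesis n2 : 1 < n.
Local Notation V := (cyl n m).
Local Notation e := (@cyl_adj n m).
Variables r s : V.
Implicit Types (pi : {ffun V -> V}) (j : 'I_m) (u v : V).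

Local Notation L pi := (trunk_set r pi s).

(** To be used with [D] the indices on one side of [j], with [j] included: a step cannot jump over
    ring [j], and from ring [j] the climb only moves along it until it meets the trunk. *)
Lemma clockwise_barrier (D : pred nat) pi j v g : rooted e r pi -> clockwise r s j pi ->
  (forall u, u != r -> D u.2 -> (u.2 != j) -> D (pi u).2) -> D j -> D v.2 ->
  path (frel pi) v g -> all (predC (mem (L pi))) (belast v g) ->
  {in belast v g, forall u, D u.2}.
Proof.
move=> rpi cw Dstep Dj; elim: g v => //= w g IH v Dv /andP[/eqP <- pg] /andP[vL gL] u.
rewrite inE => /predU1P[->//|]; apply: IH => //.
have [vj|vj] := eqVneq v.2 j.
  have /forallP/(_ v) := cw; rewrite vj eqxx vL /= => /eqP ->.
  exact: Dj.
by apply: Dstep => //; apply: contraNneq vL => ->; exact: root_trunk rpi s.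
Qed.

Lemma size_confined (q : seq V) a k : uniq q ->
  (forall u, u \in q -> (a <= u.2) && (u.2 < a + k)) -> size q <= n * k.
Proof.
move=> uq qa; pose f (u : V) := (u.1, u.2 : nat).
have fi : injective f by move=> [i j] [i' j'] [-> jj]; congr pair; exact: val_inj.
have -> : n * k = size [seq (i, h) | i <- enum 'Z_n, h <- iota a k].
  by rewrite size_allpairs -cardE card_cyl_column// size_iota.
rewrite -(size_map f); apply: uniq_leq_size; first by rewrite map_inj_uniq.
move=> _ /mapP[u /qa uk ->]; apply/allpairsP; exists (u.1, u.2 : nat).
by rewrite mem_enum mem_iota.
Qed.

(** Indices from [m] on are dropped by [insub], so the window has [h] rings only if it fits into the
    cylinder. *)
Definition window c h : seq 'I_m := pmap insub (iota c h).

Lemma mem_window c h j : (j \in window c h) = (c <= j < c + h).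
Proof. by rewrite mem_pmap_sub mem_iota. Qed.

Lemma uniq_window c h : uniq (window c h).
Proof. by rewrite pmap_sub_uniq// iota_uniq. Qed.

Lemma size_window c h : c + h <= m -> size (window c h) = h.
Proof.
move=> cm; rewrite size_pmap_sub -[RHS](size_iota c); apply/eqP; rewrite -all_count.
by apply/allP => i; rewrite mem_iota => /andP[_ /leq_trans]; apply.
Qed.

(** Otherwise there are clockwise rings both in the window going up from the ring of [v] and in the
    one going down from it. They confine the climb to 2h - 1 rings, as the ring of [v] is in both
    windows, and n (2h - 1) vertices are too few. *)
Lemma long_branch_window pi h l : rooted e r pi -> 2 * n * h <= l ->
  has_branch_ge (tree_edges pi [set r]%SET) (trunk r pi s) l -> 0 < m ->
  exists2 c, c < m /\ c + h <= m & all (fun j => ~~ clockwise r s j pi) (window c h).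
Proof.
move=> rpi hl br m0; have [h0|h0] := posnP h; first by exists 0; rewrite ?h0 ?addn0.
have [v vL lv] := branch_climb rpi br.
have [p uc b _] := climbP v rpi (root_trunk rpi s).
set g := climb pi (L pi) v in lv p uc b.
have vm := ltn_ord v.2.
have cwW c : c < m -> c + h <= m ->
    (forall c, c < m -> c + h <= m -> ~~ all (fun j => ~~ clockwise r s j pi) (window c h)) ->
    exists2 j, clockwise r s j pi & c <= j < c + h.
  move=> cm chm H; have := H c cm chm; rewrite -has_predC => /hasP[j jW /=].
  by rewrite negbK => cw; exists j => //; rewrite -mem_window.
apply: contrapT => no; have {no}no c : c < m -> c + h <= m ->
    ~~ all (fun j => ~~ clockwise r s j pi) (window c h).
  by move=> cm ch; apply/negP => H; apply: no; exists c.
have up : {in belast v g, forall u, u.2 < v.2 + h}.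
  (* When the window does not fit, the end of the cylinder is the barrier. *)
  have [vh|vh] := leqP (v.2 + h) m; last by move=> u _; exact: ltn_trans vh.
  have [j cw /andP[vj jv]] := cwW v.2 vm vh no.
  move=> u ug; apply: leq_ltn_trans jv.
  apply: (@clockwise_barrier (fun i => i <= j) pi j v g) ug => // w wr wj jw.
  by apply: leq_trans (cyl_adj_up (rooted_adj rpi wr)) _; rewrite ltn_neqAle jw.
have down : {in belast v g, forall u, v.2.+1 - h <= u.2}.
  (* Here the truncated subtraction gives 0 when the window does not fit. *)
  have [vh|vh] := leqP h v.2.+1; last by move=> u _; rewrite (eqP (ltnW vh : _ <= _)).
  have [||j cw /andP[vj jv]] := cwW (v.2.+1 - h) _ _ no.
  - by apply: leq_ltn_trans vm; rewrite leq_subLR -addn1 addnC leq_add2r.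
  - by rewrite subnK.
  move=> u ug; apply: leq_trans vj _.
  apply: (@clockwise_barrier (fun i => j <= i) pi j v g) ug => //.
    move=> w wr wj jw; rewrite -ltnS; apply: leq_trans (cyl_adj_down (rooted_adj rpi wr)).
    by rewrite ltn_neqAle eq_sym jw.
  by rewrite -ltnS -(subnK vh).
have : size (belast v g) <= n * (2 * h - 1).
  apply: (@size_confined _ (v.2.+1 - h)).
    by have := uc; rewrite lastI rcons_uniq => /andP[].
  move=> u ug; rewrite down//=; apply: leq_trans (up u ug) _.
  by move: h0; move: (nat_of_ord v.2) => a; clear; lia.
rewrite size_belast leqNgt => /negP; apply; apply: leq_trans lv; apply: leq_trans hl.
rewrite [2 * n]mulnC -mulnA ltn_mul2l (ltnW n2)/=.
by move: h0; clear; lia.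
Qed.
End LongBranches.

(** * The probability of a long branch *)

(** A vertex off [U] occurs in some climb before its last vertex, and its successor there is its
    parent. So distinct parent functions give disjoint events. *)
Lemma wpaths_inj (V : finType) (e : rel V) (r : V) (p q : {ffun V -> V}) ord (U : {set V}) :
  rooted e r p -> rooted e r q -> r \in U -> (forall u, u \notin U -> u \in ord) ->
  wpaths p ord U = wpaths q ord U -> {in ~: U, p =1 q}.
Proof.
move=> rp rq; elim: ord U => [|v ord IH] U rU Uo /=.
  by move=> _ u; rewrite finset.in_setC => /Uo.
case: ifPn => vU.
  apply: IH => // u uU; have := Uo u uU; rewrite inE => /predU1P[uv|//].
  by rewrite uv vU in uU.
move=> [cE] /= E u; rewrite finset.in_setC => uU.
have [pp _ _ lp] := climbP v rp rU; have [pq _ _ _] := climbP v rq rU.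
rewrite -cE in pq E; have [ug|ug] := boolP (u \in belast v (climb p U v)).
  move: (climb p U v) pp pq ug => g {E cE lp}; elim: g v {Uo vU} => //= w g IHg v.
  move=> /andP[/eqP pv pg] /andP[/eqP qv qg]; rewrite inE => /predU1P[->|].
    by rewrite pv qv.
  exact: IHg pg qg.
apply: (IH (U :|: [set z in v :: climb p U v])%SET) => //.
- by rewrite finset.in_setU rU.
- move=> z; rewrite finset.in_setU inE negb_or inE => /andP[zU /norP[zv _]].
  by have := Uo z zU; rewrite inE (negPf zv).
- rewrite finset.in_setC finset.in_setU (negPf uU)/= inE lastI mem_rcons inE negb_or ug andbT.
  by apply: contraNneq uU => ->.
Qed.

Section EqualWeights.
Context {R : realType} {d : measure_display} {Omega : measurableType d}.
Variables (P : probability Omega R).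

Lemma measure_equal_union (T : choiceType) (E : T -> set Omega) (k : R) (ts : seq T) :
  uniq ts -> {in ts, forall t, measurable (E t)} -> {in ts, forall t, P (E t) = k%:E} ->
  {in ts &, forall t t', t != t' -> E t `&` E t' = set0} ->
  P (\bigcup_(t in [set` ts]) E t) = ((size ts)%:R * k)%:E.
Proof.
elim: ts => [|t ts IH] /=.
  by rewrite (_ : [set` [::]] = set0) ?bigcup_set0 ?measure0 ?mul0r//; apply/seteqP; split=> x.
move=> /andP[tts uts] mE kE dE.
have sub x : x \in ts -> x \in t :: ts by rewrite inE => ->; rewrite orbT.
have mts : measurable (\bigcup_(t in [set` ts]) E t).
  by apply: fin_bigcup_measurable => // x /= xts; apply: mE; exact: sub.
have -> : \bigcup_(x in [set` t :: ts]) E x = E t `|` \bigcup_(x in [set` ts]) E x.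
  apply/seteqP; split=> w.
    by move=> [x /=]; rewrite inE => /predU1P[->|xts] Ex; [left|right; exists x].
  by case=> [Et|[x xts Ex]]; [exists t; rewrite //= mem_head|exists x => //=; exact: sub].
rewrite measureU//; last first.
- rewrite -subset0 => w [Et [x xts Ex]]; rewrite -(dE t x _ _ _) ?mem_head ?sub//.
  by apply: contraNneq tts => ->.
- exact: mE (mem_head _ _).
have IHts : P (\bigcup_(t in [set` ts]) E t) = ((size ts)%:R * k)%:E.
  by apply: IH => //; [move=> x /sub/mE|move=> x /sub/kE|move=> x y /sub xt /sub yt; exact: dE].
have Et : P (E t) = k%:E by rewrite kE ?mem_head.
rewrite [X in (X + _)%E]Et [X in (_ + X)%E]IHts -EFinD; congr EFin.
by rewrite -natr1 mulrDl mul1r addrC.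
Qed.

Lemma measurable_wilson_paths (V : finType) (X : V -> nat -> Omega -> V) ord (U : {set V}) ps :
  (forall v t x, measurable (X v t @^-1` [set x])) ->
  measurable [set w | wilson_paths (fun v t => X v t w) ord U = Some ps].
Proof.
move=> mX; elim: ord U ps => [|v ord IH] U ps /=.
  have [<-|no] := eqVneq [::] ps.
    by rewrite (_ : [set _ | _] = setT)//; apply/seteqP; split.
  rewrite (_ : [set _ | _] = set0)//; apply/seteqP; split=> w //= [E].
  by rewrite E eqxx in no.
have [vU|vU] := boolP (v \in U); first by exact: IH.
case: ps => [|p ps].
  rewrite (_ : [set _ | _] = set0)//; apply/seteqP; split=> w //=.
  by case: (walk_until _ _) => // q; case: (wilson_paths _ _ _).
rewrite (_ : [set _ | _] = erased_event X v U p `&`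
  [set w | wilson_paths (fun v t => X v t w) ord (U :|: [set z in p])%SET = Some ps]).
  apply: measurableI => //; apply: (process_sigma_measurable (X := X v)) => //.
  exact: process_sigma_erased.
apply/seteqP; split=> w /=; rewrite /erased_event /=.
  case: (walk_until _ _) => //= q; case E: (wilson_paths _ _ _) => [qs|]//= [<- <-].
  by rewrite E.
by case: (walk_until _ _) => [q|] [] //= [->] ->.
Qed.
End EqualWeights.

Section CylinderWilson.
Context {R : realType} {d : measure_display} {Omega : measurableType d}.
Variables (P : probability Omega R) (n m : nat).
Hypotheses (n2 : (1 < n)%N) (m0 : (0 < m)%N).
Local Notation V := (cyl n m).
Local Notation e := (@cyl_adj n m).
Variables (X : V -> nat -> Omega -> V) (r s : V) (ord : seq V).
Hypothesis srwX : independent_srws P e X.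
Hypothesis ends : (r \in cyl_ring n m 0 /\ s \in cyl_ring n m m.-1) \/
      (r \in cyl_ring n m m.-1 /\ s \in cyl_ring n m 0).
Hypothesis ord_enum : perm_eq (r :: s :: ord) (enum V).

Let run w := wilson (fun v t => X v t w) r (s :: ord).

Let E (pi : {ffun V -> V}) := [set w | wilson_paths (fun v t => X v t w) (s :: ord)
  [set r]%SET = Some (wpaths pi (s :: ord) [set r]%SET)].

Let ord_uniq : uniq (r :: s :: ord).
Proof. by rewrite (perm_uniq ord_enum) enum_uniq. Qed.

Let ord_mem u : u \notin [set r]%SET -> u \in s :: ord.
Proof.
rewrite finset.in_set1 => ur; have := perm_mem ord_enum u.
by rewrite mem_enum inE (negPf ur) /= => ->.
Qed.

Let sr : s != r.
Proof. by move: ord_uniq => /= /andP[]; rewrite inE negb_or eq_sym => /andP[]. Qed.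

Lemma run_tree pi w : rooted e r pi -> E pi w ->
  run w = Some (trunk r pi s, tree_edges pi [set r]%SET).
Proof.
move=> rpi Ew; apply: (wilson_tree rpi sr _ Ew) => u ur.
by apply: ord_mem; rewrite finset.in_set1.
Qed.

Lemma run_ae : {ae P, forall w, exists2 pi, rooted e r pi & E pi w}.
Proof.
have er x : connect e x r by exact: cyl_connect.
have A0 : {ae P, forall w, forall v, X v 0%N w = v}.
  by apply: filter_forall => v; exact: srw_start_ae srwX v.
have A1 : {ae P, forall w, forall v t, e (X v t w) (X v t.+1 w)}.
  by apply: filter_forall => v; exact: srw_adj_ae srwX v.
have A2 : {ae P, forall w, forall v (U : {set V}), r \in U -> exists t, X v t w \in U}.
  apply: filter_forall => v; apply: filter_forall => U.
  have [rU|rU] := boolP (r \in U); last exact: filterE.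
  by apply: filterS (srw_hit_ae srwX er v rU) => w.
apply: filterS3 A0 A1 A2 => w x0 xe hit.
(* Any function fixing [r] will do: at the start the tree consists of the root alone. *)
pose pi0 : {ffun V -> V} := [ffun=> r].
have [|pi [rpi _ Ew]] := @wilson_outcome _ e r (fun v t => X v t w) x0 xe hit
  (s :: ord) [set r]%SET pi0 _ ord_mem.
  split; rewrite ?finset.set11 ?ffunE// => u; rewrite finset.in_set1 => /eqP ->.
  by rewrite ffunE finset.set11 eqxx; split=> //; exact: connect0.
by exists pi.
Qed.

Lemma run_spanning_trunk_ae : {ae P, forall w, exists L T,
  [/\ run w = Some (L, T), spanning_tree e T & is_trunk T L]}.
Proof.
apply: filterS run_ae => w [pi rpi Ew].
exists (trunk r pi s), (tree_edges pi [set r]%SET); split.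
- exact: run_tree.
- exact: tree_spanning rpi.
- split; first exact: trunk_simple rpi s.
  move=> k km; have [v vt vk] := trunk_meets_ring ends rpi km.
  by exists v; rewrite // inE vk.
Qed.

Let bad l := [set pi in parents r | `[< has_branch_ge (tree_edges pi [set r]%SET)
  (trunk r pi s) l >]]%SET.

(** A union bound over the lowest ring [c] of the window, which takes at most [m] values. *)
Lemma card_long_branch h l : (2 * n * h <= l)%N ->
  ((4 ^ n).+1 ^ h * #|bad l| <= m * ((4 ^ n) ^ h * #|parents r : {set {ffun V -> V}}|))%N.
Proof.
move=> hl; pose W (c : 'I_m) := all_bad (parents r) (clockwise r s) (window m c h).
have sub : bad l \subset (\bigcup_(c < m | (c + h <= m)%N) W c)%SET.
  apply/fintype.subsetP => pi; rewrite !inE => /andP[rpi /asboolP br].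
  have [c [cm ch] H] := long_branch_window n2 rpi hl br m0.
  by apply/bigcupP; exists (Ordinal cm); rewrite // inE inE rpi.
have cb : (#|bad l| <= \sum_(c < m | (c + h <= m)%N) #|W c|)%N.
  apply: leq_trans (subset_leq_card sub) _.
  elim/big_rec2: _ => [|c k A _ Ak]; first by rewrite cards0.
  by apply: leq_trans (leq_card_setU _ _) _; rewrite leq_add2l.
apply: leq_trans (leq_mul (leqnn _) cb) _; rewrite big_distrr/=.
apply: (@leq_trans (\sum_(c < m | (c + h <= m)%N) (4 ^ n) ^ h * #|parents r : {set {ffun V -> V}}|)%N).
  apply: leq_sum => c ch; have := card_not_clockwise n2 ends (uniq_window m c h).
  by rewrite size_window.
rewrite sum_nat_const leq_mul2r; apply/orP; right.
by rewrite -[X in (_ <= X)%N]card_ord max_card.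
Qed.

(** The run is determined by its list of paths, and there are countably many such lists. *)
Lemma measurable_long_branch l :
  measurable [set w | exists L T, run w = Some (L, T) /\ has_branch_ge T L l].
Proof.
rewrite (_ : [set _ | _] = \bigcup_(ps in [set ps : seq (seq V) |
    has_branch_ge (\bigcup_(p <- ps) path_edges p)%SET (head [::] ps) l])
    [set w | wilson_paths (fun v t => X v t w) (s :: ord) [set r]%SET = Some ps]).
  rewrite bigcup_mkcond; apply: countable_bigcupT_measurable => // ps.
  case: ifP => _ //; apply: measurable_wilson_paths => v t x.
  exact: srw_measurable srwX v t x.
apply/seteqP; split=> w.
  move=> [L [T [+ br]]]; rewrite /run /wilson.
  case E1 : (wilson_paths _ _ _) => [ps|//] /= [LE TE].
  by exists ps => //=; rewrite LE TE.
move=> [ps br wps]; exists (head [::] ps), (\bigcup_(p <- ps) path_edges p)%SET.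
split=> //; rewrite /run /wilson.
by rewrite [wilson_paths _ _ _]wps.
Qed.

Lemma long_branch_prob h l : (2 * n * h <= l)%N ->
  (P [set w | exists L T, run w = Some (L, T) /\ has_branch_ge T L l]
   <= (m%:R * ((4 ^ n)%:R / (4 ^ n).+1%:R) ^+ h)%:E)%E.
Proof.
move=> hl; set B := [set w | _].
have mB : measurable B by exact: measurable_long_branch.
have er x : connect e x r by exact: cyl_connect.
(* All parents are neighbours, so each step probability is an inverse degree and the product is the
   same for every rooted [pi]. *)
pose w0 : R := \prod_(u in ~: [set r]%SET) (#|[pred w | e u w]|%:R)^-1.
pose K0 := green_prod (srw_step e) (~: [set r]%SET) * w0.
have PE pi : rooted e r pi -> P (E pi) = K0%:E.
  move=> rpi; have /= := wilson_paths_prob srwX er rpi (finset.set11 r).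
  move=> -> //; last by have /andP[] := ord_uniq.
  congr (_ * _)%:E; apply: eq_bigr => u; rewrite finset.in_setC finset.in_set1 => ur.
  by rewrite /srw_step (rooted_adj rpi ur).
have mE pi : measurable (E pi).
  by apply: measurable_wilson_paths => v t x; exact: srw_measurable srwX v t x.
have dE pi pi' : rooted e r pi -> rooted e r pi' -> pi != pi' -> E pi `&` E pi' = set0.
  move=> rpi rpi' /eqP ne; rewrite -subset0 => w [E1 E2]; apply: ne.
  have [eqW] : Some (wpaths pi (s :: ord) [set r]%SET) = Some (wpaths pi' (s :: ord) [set r]%SET).
    by rewrite -[LHS]E1 -[RHS]E2.
  apply/ffunP => u; have [->|ur] := eqVneq u r; first by rewrite (rooted_root rpi) (rooted_root rpi').
  apply: (wpaths_inj rpi rpi' (finset.set11 r) ord_mem eqW).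
  by rewrite finset.in_setC finset.in_set1.
have union (A : {set {ffun V -> V}}) : A \subset parents r ->
    P (\bigcup_(pi in [set` enum A]) E pi) = (#|A|%:R * K0)%:E.
  move=> /fintype.subsetP Ap; have rA pi : pi \in enum A -> rooted e r pi.
    by rewrite mem_enum => /Ap; rewrite inE.
  rewrite cardE; apply: measure_equal_union; first exact: enum_uniq.
  - by move=> pi _; exact: mE.
  - by move=> pi /rA; exact: PE.
  - by move=> pi pi' /rA rpi /rA rpi'; exact: dE.
have bp : bad l \subset parents r by apply/fintype.subsetP => pi; rewrite inE => /andP[].
have total : #|parents r : {set {ffun V -> V}}|%:R * K0 <= 1.
  rewrite -lee_fin -union//; apply: probability_le1.
  by apply: fin_bigcup_measurable.
(* Outside a null set some rooted [pi] describes the run, and then the branch condition is that of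
   its tree. *)
have PB : (P B <= (#|bad l|%:R * K0)%:E)%E.
  rewrite -(union _ bp); set G := \bigcup_(pi in [set` enum (parents r)]) E pi.
  have mG : measurable G by exact: fin_bigcup_measurable.
  have mU : measurable (\bigcup_(pi in [set` enum (bad l)]) E pi).
    exact: fin_bigcup_measurable.
  have G0 : P (~` G) = 0.
    apply/negligibleP; first exact: measurableC.
    apply: filterS run_ae => w [pi rpi Ew]; exists pi => //=.
    by rewrite mem_enum inE.
  apply: (@le_trans _ _ (P (\bigcup_(pi in [set` enum (bad l)]) E pi `|` ~` G))).
    apply: le_measure; rewrite ?inE//; first by apply: measurableU => //; exact: measurableC.
    move=> w [L [T [runw br]]]; have [[pi]|] := pselect (G w); last by right.
    rewrite /= mem_enum inE => rpi Ew; left; exists pi => //=.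
    rewrite mem_enum !inE rpi; apply/asboolP.
    by move: runw; rewrite (run_tree rpi Ew) => -[-> ->].
  apply: (le_trans (measureU2 P mU (measurableC mG))).
  by rewrite [X in (_ + X)%E]G0 adde0.
apply: (le_trans PB); rewrite lee_fin.
have [b0|b0] := eqVneq #|bad l| 0%N.
  by rewrite b0 mul0r mulr_ge0// exprn_ge0// divr_ge0.
(* [K0] is nonnegative as the probability of an actual event, which takes some member of [bad l];
   hence the separate case of an empty set. *)
have K00 : 0 <= K0.
  have [pi] : exists pi, pi \in bad l by apply/set0Pn; rewrite -card_gt0 lt0n.
  by rewrite inE => /andP[]; rewrite inE => rpi _; rewrite -lee_fin -(PE pi)//.
have := card_long_branch hl; rewrite -(ler_nat R) !natrM !natrX => cb.
rewrite expr_div_n [leRHS]mulrA ler_pdivlMr ?exprn_gt0//.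
rewrite mulrAC mulrC [X in _ * X]mulrC; apply: le_trans (ler_wpM2l K00 cb) _.
rewrite [K0 * _]mulrC -!mulrA ler_wpM2l// ler_piMr// exprn_ge0//.
Qed.
End CylinderWilson.

Lemma bernoulli_le (R : realFieldType) (x : R) k : 0 <= x <= 1 -> 1 - k%:R * x <= (1 - x) ^+ k.
Proof.
move=> /andP[x0 x1]; elim: k => [|k IH]; first by rewrite mul0r subr0.
rewrite exprS; apply: le_trans (ler_wpM2l _ IH); last by rewrite subr_ge0.
rewrite -natr1; have : 0 <= k%:R * (x * x) by rewrite mulr_ge0// mulr_ge0.
by nra.
Qed.

Theorem theorem1 (R : realType) (n : nat) (hn : (3 <= n)%N) :
  exists C theta : R, [/\ 0 < C, 0 < theta, theta < 1 &
    forall (m : nat) (hm : (2 <= m)%N)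
      (d : measure_display) (Omega : measurableType d)
      (P : probability Omega R)
      (X : cyl n m -> nat -> Omega -> cyl n m)
      (r s : cyl n m) (ord : seq (cyl n m)),
      independent_srws P (@cyl_adj n m) X ->
      (r \in cyl_ring n m 0 /\ s \in cyl_ring n m m.-1) \/
      (r \in cyl_ring n m m.-1 /\ s \in cyl_ring n m 0) ->
      perm_eq (r :: s :: ord) (enum (cyl n m)) ->
      let run w := wilson (fun v t => X v t w) r (s :: ord) in
      {ae P, forall w, exists L T,
          [/\ run w = Some (L, T), spanning_tree (@cyl_adj n m) T
            & is_trunk T L]} /\
      forall l : nat,
        (P [set w | exists L T, run w = Some (L, T) /\ has_branch_ge T L l]
         <= (C * m%:R * (n%:R - 1) * theta ^+ l)%:E)%E].
Proof.
pose N := (2 * n)%N; pose rho : R := (4 ^ n)%:R / (4 ^ n).+1%:R.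
(* Bernoulli's inequality gives theta ^ N >= rho for this choice, so no N-th root of rho has to be
   taken. *)
pose theta : R := 1 - (1 - rho) / N%:R.
have N0 : (0 < N)%N by rewrite /N muln_gt0 (ltn_trans _ hn).
have rho0 : 0 < rho by rewrite divr_gt0// ltr0n expn_gt0.
have rho1 : rho < 1 by rewrite ltr_pdivrMr ?ltr0n// mul1r ltr_nat.
have N1 : (1 : R) <= N%:R by rewrite ler1n.
have x1 : 0 < (1 - rho) / N%:R by rewrite divr_gt0 ?subr_gt0// ltr0n.
have x2 : (1 - rho) / N%:R < 1.
  by rewrite ltr_pdivrMr ?ltr0n// mul1r (lt_le_trans _ N1)// ltrBlDr ltrDl.
have theta0 : 0 < theta by rewrite subr_gt0.
have theta1 : theta < 1 by rewrite ltrBlDr ltrDl.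
have rho_theta : rho <= theta ^+ N.
  apply: le_trans (bernoulli_le _ _); last by rewrite !ltW.
  by rewrite mulrCA divff ?mulr1 ?subKr// pnatr_eq0 -lt0n.
(* The constant pays for rounding [l] down to a multiple of [N]: l < N (h + 1), hence theta ^ (N h)
   is at most theta ^ (l - N). *)
exists (theta ^- N), theta; split=> //; first by rewrite invr_gt0 exprn_gt0.
move=> m hm d Omega P X r s ord srwX ends perm run.
have n2 : (1 < n)%N by exact: ltn_trans hn.
have m0 : (0 < m)%N by exact: ltn_trans hm.
split; first exact: run_spanning_trunk_ae srwX ends perm.
move=> l; pose h := (l %/ N)%N.
have hl : (2 * n * h <= l)%N by rewrite mulnC leq_trunc_div.
apply: le_trans (long_branch_prob n2 m0 srwX ends perm hl) _.
rewrite lee_fin -/rho.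
have step : rho ^+ h <= theta ^- N * theta ^+ l.
  apply: (@le_trans _ _ ((theta ^+ N) ^+ h)).
    by rewrite lerXn2r// nnegrE ?exprn_ge0 ?ltW.
  rewrite [leRHS]mulrC ler_pdivlMr ?exprn_gt0// -exprM -exprD ler_wiXn2l ?ltW//.
  by rewrite -mulnSr mulnC ltnW// ltn_ceil.
rewrite [theta ^- N * _]mulrC -!mulrA ler_wpM2l// mulrCA.
(* The factor n - 1 is at least 1, so inserting it only enlarges the right-hand side. *)
apply: le_trans step _; rewrite ler_peMl//; last first.
  by rewrite lerBrDr -[1 + 1]/(2%:R) ler_nat.
by rewrite mulr_ge0 ?invr_ge0 ?exprn_ge0 ?ltW.
Qed.
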